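(* Let $d\ge 3$, let $\mathbb{T}_d$ be the $d$-regular tree rooted at a vertex $\rho$, and let $G$ be a graph containing an infinite ray $0,1,2,\ldots$. Consider first passage percolation on $\mathbb{T}_d\times G$ with i.i.d. edge weights distributed as a random variable $X\ge 0$ with $\mathbf{E}[X]<\infty$, and let $D(n)=d_X((\rho,0),(\rho,n))$ be the first passage percolation distance between $(\rho,0)$ and $(\rho,n)$. Suppose that 1. $\mathbf{E}[X^{1+\varepsilon}]<\infty$ for some $\varepsilon>0$, and 2. there exist constants $C,K<\infty$ such that $\mathbf{E}[|\gamma_m|]<Cn^{K}$ for all $n\ge 1$, where $\gamma_m=\gamma_m(n)$ is the path from $(\rho,0)$ to $(\rho,n)$ in $\mathbb{T}_d\times G$ that realizes the minimum defining $D(n)$, and $|\gamma_m|$ is its number of edges. Then the sequence of random variables $$\frac{D(n)-\mathbf{E}[D(n)]}{\log n},\qquad n\ge 2,$$ is tight.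
   Context: The $d$-regular tree $\mathbb{T}_d$ is the infinite tree in which every vertex has degree $d$. An infinite ray $0,1,2,\ldots$ in $G$ is a sequence of distinct vertices of $G$, denoted $0,1,2,\ldots$, with $j$ and $j+1$ adjacent for every $j\ge 0$. The product $\mathbb{T}\times G$ is the Cartesian product graph: its vertices are pairs $(v,g)$ with $v$ a vertex of $\mathbb{T}$ and $g$ a vertex of $G$, and $(v,g)$, $(v',g')$ are adjacent iff either $v=v'$ and $g,g'$ are adjacent in $G$, or $g=g'$ and $v,v'$ are adjacent in $\mathbb{T}$. First passage percolation: to each edge $e$ of the graph attach a random variable $X_e$, all $X_e$ being independent copies of a random variable $X\ge 0$ with $\mathbf{E}[X]<\infty$. For a (finite) path $\gamma$, $|\gamma|$ denotes the number of its edges and $|\gamma|_X=\sum_{e\in\gamma}X_e$. The random (pseudo-)metric is $$d_X(v,w)=\min\{|\gamma|_X : \gamma \text{ is a path from } v \text{ to } w\}.$$ Hypothesis 2 presupposes that almost surely a minimizing path $\gamma_m$ for $D(n)$ exists (if it is not unique, $\gamma_m$ is a measurably chosen minimizing path). A sequence of real random variables $(Z_n)$ is tight if for every $\eta>0$ there is $M<\infty$ with $\mathbf{P}(|Z_n|>M)\le\eta$ for all $n$ in the index set.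
   Formalization: The graph G is assumed to have at most countably many neighbours at every vertex; without this the distance D(n) need not be a random variable determined by the law of the weights, and the claim can fail for graphs with vertices of uncountable degree. *)

(* Defs.v *)
From HB Require Import structures.
From mathcomp Require Import all_boot all_order all_algebra.
From mathcomp Require Import finmap.
From mathcomp Require Import all_classical all_reals all_analysis.
Set Implicit Arguments.
Unset Strict Implicit.
Unset Printing Implicit Defensive.
Import Order.TTheory GRing.Theory Num.Theory.
Local Open Scope card_scope.
Local Open Scope classical_set_scope.
Local Open Scope ring_scope.

(* Boolean adjacency on a choiceType is no restriction: classically, every type
   is a choiceType and every relation is decidable. *)
Record sgraph := SGraph {
  vertex :> choiceType;
  adj : rel vertex;
  adj_sym : symmetric adj;
  adj_irr : irreflexive adj
}.

Section Graphs.
Variable G : sgraph.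

(* The tail p stands for the path x :: p, so that |x :: p| = size p. *)
Definition is_path (x y : G) (p : seq G) : Prop :=
  [/\ path (@adj G) x p, last x p = y & uniq (x :: p)].

Definition is_ray (r : nat -> G) : Prop :=
  injective r /\ forall j, adj (r j) (r j.+1).

Definition is_connected : Prop := forall x y : G, exists p, is_path x y p.

Definition is_acyclic : Prop :=
  forall c : seq G, (2 < size c)%N -> ~ ucycle (@adj G) c.

Definition is_tree : Prop := is_connected /\ is_acyclic.

Definition is_regular (d : nat) : Prop :=
  forall x : G, [set y | adj x y] #= `I_d.

Definition locally_countable : Prop :=
  forall x : G, countable [set y | adj x y].

(* Unoriented edges, as two-element vertex sets. *)
Definition edge_set : set (set G) :=
  [set e | exists u v : G, adj u v /\ e = [set u; v]].

Definition path_edges (x : G) (p : seq G) : seq (set G) :=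
  pairmap (fun u v : G => [set u; v]) x p.

End Graphs.

Arguments edge_set G : clear implicits.

(* The d-regular tree is unique up to isomorphism; it is infinite as soon as
   d >= 2. *)
Definition is_regular_tree (d : nat) (T : sgraph) : Prop :=
  is_tree T /\ is_regular T d.

Section CartesianProduct.
Variables T G : sgraph.

Definition prod_adj : rel (T * G)%type := fun a b =>
  (a.1 == b.1) && adj a.2 b.2 || (a.2 == b.2) && adj a.1 b.1.

Lemma prod_adj_sym : symmetric prod_adj.
Proof.
by move=> a b; rewrite /prod_adj (eq_sym b.1) (eq_sym b.2) !(adj_sym b.1, adj_sym b.2).
Qed.

Lemma prod_adj_irr : irreflexive prod_adj.
Proof. by move=> a; rewrite /prod_adj !adj_irr !andbF. Qed.

Definition cartesian_product : sgraph := SGraph prod_adj_sym prod_adj_irr.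

End CartesianProduct.

Section FirstPassagePercolation.
Context (R : realType) (H : sgraph).

(* |gamma|_w for the path gamma = x :: p and edge weights w; the values of w
   outside edge_set H play no role. *)
Definition path_weight (w : set H -> R) (x : H) (p : seq H) : R :=
  \sum_(e <- path_edges x p) w e.

(* The minimum defining d_X is an infimum in general; [is_minimizing] below
   says that it is attained by a given path. *)
Definition fpp_dist (w : set H -> R) (x y : H) : R :=
  inf [set path_weight w x p | p in [set p | is_path x y p]].

Definition is_minimizing (w : set H -> R) (x y : H) (p : seq H) : Prop :=
  is_path x y p /\ path_weight w x p = fpp_dist w x y.

End FirstPassagePercolation.

Section Probability.
Context (dO : measure_display) (Omega : measurableType dO) (R : realType).
Variable P : probability Omega R.

Definition mutually_independent (I : choiceType) (A : set I)
    (X : I -> {RV P >-> R}) : Prop :=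
  forall (s : {fset I}) (B : I -> set R),
    [set` s] `<=` A -> (forall i, measurable (B i)) ->
    P (\bigcap_(i in [set` s]) (X i @^-1` B i)) =
    (\prod_(i <- s) P (X i @^-1` B i))%E.

Definition same_law (dO' : measure_display) (Omega' : measurableType dO')
    (Q : probability Omega' R) (X : {RV P >-> R}) (Y : {RV Q >-> R}) : Prop :=
  forall B : set R, measurable B -> distribution P X B = distribution Q Y B.

Definition iid_edge_weights (H : sgraph) (X : set H -> {RV P >-> R})
    (dO' : measure_display) (Omega' : measurableType dO')
    (Q : probability Omega' R) (X0 : {RV Q >-> R}) : Prop :=
  [/\ mutually_independent (edge_set H) X,
      forall e, edge_set H e -> same_law (X e) X0 &
      forall e w, edge_set H e -> 0 <= X e w].

(* Measurability is with respect to the discrete sigma-algebra on paths. *)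
Definition minimizing_selection (H : sgraph) (X : set H -> {RV P >-> R})
    (x y : H) (gamma : Omega -> seq H) : Prop :=
  (forall S : set (seq H), measurable (gamma @^-1` S)) /\
  {ae P, forall w, is_minimizing (fun e => X e w) x y (gamma w)}.

Definition tight (N : set nat) (Z : nat -> Omega -> R) : Prop :=
  forall eta : R, 0 < eta -> exists M : R, forall n, N n ->
    (P [set w | (M < `|Z n w|)%R] <= eta%:E)%E.

End Probability.

(* Main.v *)
Require Import Defs.
From HB Require Import structures.
From mathcomp Require Import all_boot all_order all_algebra.
From mathcomp Require Import finmap.
From mathcomp Require Import all_classical all_reals all_analysis.
From mathcomp Require Import measurable_realfun.
From mathcomp Require Import zify ring lra.
Set Implicit Arguments.
Unset Strict Implicit.
Unset Printing Implicit Defensive.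
Import Order.TTheory GRing.Theory Num.Theory.
Local Open Scope classical_set_scope.
Local Open Scope ring_scope.

(** The reason is that the mean deviation E |D - E D| of D = D(n) is O(log n);
    tightness then follows from Markov's inequality.

    Suppose that f and g are independent with the same law and that
    D <= f, D <= g + h with h >= 0. If E f - E D is bounded by delta, then
    E |f - g| <= 2 delta + 2 E h, and by independence E |f - E f| <= E |f - g|,
    so that E |D - E D| <= 4 delta + 2 E h ([mean_deviation_le],
    [indep_mean_deviation]). Such f and g come from a cut of the tree. At
    distance about c log n from rho there are more than n^M vertices, while the
    minimizing path has polynomial mean length; hence some vertex v at that
    distance is visited by the path with probability at most n^(-M')
    ([least_visited], [rarely_visited]). The last edge of the walk from rho to v
    separates the tree into two copies of the rooted tree of words over d-1
    letters ([branch_inj], [branch_disjoint], [branch_cover]). Let f be the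
    passage time between (rho, 0) and (rho, n) restricted to the side of rho,
    and g the same functional of the weights on the side of v. They use disjoint
    sets of edges, hence are independent with the same law ([block_law],
    [block_indep]).

    - The counterpart of rho on the side of v is within O(log n) of rho
      ([branch_split]), so that D <= g + h for the cost h of two walks with
      O(log n) edges.
    - f = D unless the minimizing path visits v, and f is always at most the
      weight of the ray. The moment of order 1 + eps makes the expectation of
      that weight on the rare event bounded ([path_weight_indic_le]), hence
      E f - E D = O(1).

    These two estimates are combined in [mean_deviation_ray_dist]; the theorem
    only has to choose the depth of the cut and the truncation level. *)

(** * Non-backtracking walks and branches of a regular tree *)

Section NonBacktracking.
Variable T : sgraph.
Implicit Types (x y z : T) (p q s : seq T).

Definition nonbacktracking s : Prop :=
  forall x0 k, (k.+2 < size s)%N -> nth x0 s k != nth x0 s k.+2.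

Lemma nonbacktracking_behead x s :
  nonbacktracking (x :: s) -> nonbacktracking s.
Proof. by move=> h x0 k ks; exact: (h x0 k.+1). Qed.

Lemma nonbacktracking_cons x y z s : x != z ->
  nonbacktracking [:: y, z & s] -> nonbacktracking [:: x, y, z & s].
Proof. by move=> xz h x0 [|k] // ks; exact: (h x0 k). Qed.

Lemma nonbacktracking_rcons s x :
  nonbacktracking (rcons s x) -> nonbacktracking s.
Proof.
move=> h x0 k ks; have := h x0 k; rewrite size_rcons !nth_rcons ks.
have -> : (k < size s)%N by lia.
by apply; lia.
Qed.

(** A vertex met twice would close a cycle: the walk between two consecutive
    visits has at least two other vertices, because the graph has no loops and
    the walk does not turn back. *)
Lemma acyclic_nonbacktracking_uniq x p : is_acyclic T ->
  path (@adj T) x p -> nonbacktracking (x :: p) -> uniq (x :: p).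
Proof.
move=> acT; elim: p x => // y p IH x xp nb.
have yp : uniq (y :: p).
  by apply: IH; [case/andP: xp | exact: nonbacktracking_behead nb].
rewrite cons_uniq yp andbT; apply/negP => xin.
move: xp nb yp; case/splitPr: xin => p1 p2 xp nb yp.
have p12 : (1 < size p1)%N.
  case: p1 xp nb {yp} => [|a [|b p1]] //=; first by rewrite adj_irr.
  by move=> _ /(_ x 0%N isT) /=; rewrite eqxx.
apply: (acT (x :: p1)) => //.
rewrite /ucycle /= rcons_path.
move: xp; rewrite cat_path /= => /and3P[-> -> _] /=.
move: yp; rewrite cat_uniq /= => /and3P[-> + _].
by rewrite negb_or => /andP[-> _].
Qed.

(** Two different walks between the same vertices diverge somewhere; reversing
    one of them up to that place and continuing along the other closes a walk
    that still never backtracks. *)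
Lemma acyclic_nonbacktracking_inj x p q : is_acyclic T ->
  path (@adj T) x p -> path (@adj T) x q ->
  nonbacktracking (x :: p) -> nonbacktracking (x :: q) ->
  last x p = last x q -> p = q.
Proof.
move=> acT; elim: p x q => [|y p IH] x q xp xq np nq /=.
  have := acyclic_nonbacktracking_uniq acT xq nq.
  case: q {xq nq} => // z q /= /andP[+ _] xl.
  by rewrite xl mem_last.
case: q xq nq => [_ _ /= xl|z q xq nq lpq].
  have := acyclic_nonbacktracking_uniq acT xp np.
  by rewrite /= -[X in X \notin _]xl mem_last.
have [yz|yz] := eqVneq y z.
  rewrite -yz in lpq xq nq *; congr cons; apply: IH lpq.
  - by case/andP: xp.
  - by case/andP: xq.
  - exact: nonbacktracking_behead np.
  - exact: nonbacktracking_behead nq.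
have Wp : path (@adj T) (last x (y :: p)) (rev (belast x (y :: p)) ++ (z :: q)).
  rewrite cat_path rev_path.
  rewrite (_ : last _ (rev _) = x); last by rewrite /= rev_cons last_rcons.
  rewrite xq andbT; apply: sub_path xp => u v; by rewrite adj_sym.
have Wn : nonbacktracking (last x (y :: p) :: rev (belast x (y :: p)) ++ (z :: q)).
  rewrite -cat_cons -rev_rcons -lastI => x0 k.
  have szW : size (rev (x :: y :: p)) = (size p).+2 by rewrite size_rev.
  rewrite size_cat szW => kl; rewrite !nth_cat !szW.
  have [k1|k1] := ltnP k.+2 (size p).+2.
    have -> : (k < (size p).+2)%N by lia.
    rewrite !nth_rev /=; [|lia..].
    have := np x0 (size p - k.+1)%N.
    rewrite (_ : (_ - _).+2 = (size p).+1 - k)%N; last by lia.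
    rewrite (_ : ((size p).+2 - k.+1 = (size p).+1 - k)%N); last by lia.
    rewrite (_ : ((size p).+2 - k.+3 = size p - k.+1)%N); last by lia.
    by rewrite eq_sym; apply => /=; lia.
  have [k2|k2] := ltnP k (size p).+2; last first.
    have := nq x0 (k - (size p).+2).+1.
    rewrite (_ : (k.+2 - (size p).+2)%N = (k - (size p).+2).+2); last by lia.
    by apply; move: kl => /=; lia.
  have [kE|kE] : k = size p \/ k = (size p).+1 by lia.
    rewrite kE nth_rev /=; last by lia.
    by rewrite subnn (_ : ((size p).+2 - (size p).+1)%N = 1%N) //; lia.
  rewrite kE in kl *; rewrite nth_rev /=; last by lia.
  rewrite subnn /= (_ : ((size p).+3 - (size p).+2)%N = 1%N); last by lia.
  by apply: (nq x0 0%N); move: kl => /=; lia.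
have := acyclic_nonbacktracking_uniq acT Wp Wn.
by rewrite [last x _]lpq cons_uniq mem_cat (mem_last z q) orbT.
Qed.

End NonBacktracking.

Section WordTree.
Variable k : nat.

(** Words as the vertices of the rooted k-ary tree: removing the first letter
    leads to the parent. *)
Definition word_adj : rel (seq 'I_k) := fun s t =>
  ((s != [::]) && (behead s == t)) || ((t != [::]) && (behead t == s)).

Lemma word_adj_sym : symmetric word_adj.
Proof. by move=> s t; rewrite /word_adj orbC. Qed.

Lemma word_adj_irr : irreflexive word_adj.
Proof.
move=> [|i s] //; rewrite /word_adj /= orbb; apply/eqP => /(congr1 size) /=.
by lia.
Qed.

Definition word_tree : sgraph := SGraph word_adj_sym word_adj_irr.

Lemma word_adjP (s t : word_tree) : adj s t <->
  (exists i, t = i :: s) \/ (exists i, s = i :: t).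
Proof.
split.
  move=> /orP[/andP[]|/andP[]].
    by case: s => // i s _ /eqP <-; right; exists i.
  by case: t => // i t _ /eqP <-; left; exists i.
by case=> -[i ->]; rewrite /adj /= /word_adj /= eqxx ?orbT.
Qed.

Lemma word_tree_locally_countable : locally_countable word_tree.
Proof.
move=> s; apply: (@sub_countable _ _ _ [set: seq 'I_k]) => //.
exact: subset_card_le.
Qed.

End WordTree.

Section Branch.
Variables (d : nat) (T : sgraph).
Hypothesis hT : is_regular_tree d T.
Implicit Types (a b x y : T).

Lemma regular_finite x : finite_set [set y | adj x y].
Proof. by case: hT => _ /(_ x) h; exists d. Qed.

Lemma regular_locally_countable : locally_countable T.
Proof. by move=> x; apply: finite_set_countable; exact: regular_finite. Qed.

(** The neighbours of b by which a walk coming from a can go on. *)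
Definition forward a b : {fset T} := (fset_set [set y | adj b y] `\ a)%fset.

Lemma in_forward a b y : (y \in forward a b) = (y != a) && adj b y.
Proof.
rewrite in_fsetD1 in_fset_set ?mem_setE //; exact: regular_finite.
Qed.

Lemma card_forward a b : adj a b -> #|` forward a b| = d.-1.
Proof.
move=> ab; have := cardfsD1 a (fset_set [set y | adj b y]).
have -> : #|` fset_set [set y | adj b y]| = d.
  by apply: card_eq_fsetP; rewrite fset_setK; [case: hT|exact: regular_finite].
rewrite in_fset_set; last exact: regular_finite.
have -> : (a \in [set y | adj b y]) by apply/mem_set; rewrite /= adj_sym.
by rewrite add1n => ->.
Qed.

(** The oriented edge reached from the edge (a, b) by a non-backtracking walk
    whose successive choices are the letters of s, read from right to left. *)
Fixpoint branch_edge a b (s : seq 'I_d.-1) : T * T :=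
  if s is i :: s' then
    let e := branch_edge a b s' in (e.2, nth e.2 (forward e.1 e.2) i)
  else (a, b).

Definition branch a b (s : word_tree d.-1) : T := (branch_edge a b s).2.

Lemma nth_forward a b (i : 'I_d.-1) : adj a b ->
  nth b (forward a b) i \in forward a b.
Proof. by move=> ab; apply: mem_nth; rewrite card_forward. Qed.

Lemma branch_edge_adj a b s : adj a b ->
  adj (branch_edge a b s).1 (branch_edge a b s).2.
Proof.
move=> ab; elim: s => // i s IH /=.
by have := nth_forward i IH; rewrite in_forward => /andP[].
Qed.

Lemma branch_cons_adj a b i s : adj a b -> adj (branch a b s) (branch a b (i :: s)).
Proof. by move=> ab; exact: (branch_edge_adj (i :: s) ab). Qed.

Lemma branch_hom a b (s t : word_tree d.-1) : adj a b -> adj s t ->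
  adj (branch a b s) (branch a b t).
Proof.
move=> ab /word_adjP[][i ->]; first exact: branch_cons_adj.
rewrite adj_sym; exact: branch_cons_adj.
Qed.

(** The way back from branch a b s to b, and then to a. *)
Fixpoint trace a b (s : seq 'I_d.-1) : seq T :=
  if s is i :: s' then branch a b s' :: trace a b s' else [:: a].

Lemma trace_path a b s : adj a b -> path (@adj T) (branch a b s) (trace a b s).
Proof.
move=> ab; elim: s => [|i s IH]; first by rewrite /= adj_sym ab.
by rewrite /= IH andbT adj_sym branch_cons_adj.
Qed.

Lemma trace_nonbacktracking a b s : adj a b ->
  nonbacktracking (branch a b s :: trace a b s).
Proof.
move=> ab; elim: s => [|i s IH] //.
have h : (branch_edge a b s).1 = head b (trace a b s) by case: s {IH}.
move: IH; rewrite [trace a b (i :: s)]/=.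
case E : (trace a b s) => [|z q]; first by case: s E {h}.
apply: nonbacktracking_cons.
move: h; rewrite E /= => <-.
have := nth_forward i (branch_edge_adj s ab).
by rewrite in_forward => /andP[].
Qed.

Lemma trace_last a b x s : last x (trace a b s) = a.
Proof. by elim: s x => //= i s IH x. Qed.

(** The traces of two words with the same end vertex are non-backtracking walks
    with the same ends, hence equal; the letters can be read off a trace. *)
Lemma branch_inj a b : adj a b -> injective (branch a b).
Proof.
move=> ab s t bst.
have : branch a b s :: trace a b s = branch a b t :: trace a b t.
  rewrite -bst; congr cons.
  apply: (@acyclic_nonbacktracking_inj _ (branch a b s)); first by case: hT => -[].
  - exact: trace_path.
  - by rewrite bst; exact: trace_path.
  - exact: trace_nonbacktracking.
  - by rewrite bst; exact: trace_nonbacktracking.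
  - by rewrite !trace_last.
elim: s t {bst} => [|i s IH] [|j t] //=.
- by case=> _ _ /(congr1 size); case: t.
- by case=> _ _ /(congr1 size); case: s {IH}.
case=> + h1 h2; have {IH} <- : s = t by apply: IH; rewrite h1 h2.
rewrite /branch /= => /eqP; rewrite nth_uniq ?fset_uniq //.
- by move=> /eqP/val_inj ->.
- by rewrite card_forward //; exact: branch_edge_adj.
- by rewrite card_forward //; exact: branch_edge_adj.
Qed.

(** A common vertex z would have two different traces leading to b: the one
    that has not crossed the edge yet, and the one that ends with it. *)
Lemma branch_disjoint a b s t : adj a b -> branch a b s <> branch b a t.
Proof.
move=> ab st; have ba : adj b a by rewrite adj_sym.
have acT : is_acyclic T by case: hT => -[].
set z := branch a b s in st.
have [p E] : exists p, z :: trace a b s = rcons (z :: p) a /\ last z p = b.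
  rewrite /z; elim: (s) => [|i u [p [pE pl]]]; first by exists [::].
  exists (branch a b u :: p) => /=; split=> //.
  by move: pE => /= [<-].
case: E => E pl.
have zp : path (@adj T) z p.
  have := trace_path s ab; rewrite -/z.
  by move: E => /= [->]; rewrite rcons_path => /andP[].
have nzp : nonbacktracking (z :: p).
  by apply: (@nonbacktracking_rcons _ _ a); rewrite -E; exact: trace_nonbacktracking.
have pE : p = trace b a t.
  apply: (@acyclic_nonbacktracking_inj _ z) => //.
  - by rewrite st; exact: trace_path.
  - by rewrite st; exact: trace_nonbacktracking.
  - by rewrite trace_last.
have : uniq (z :: trace a b s).
  apply: acyclic_nonbacktracking_uniq => //; first exact: trace_path.
  exact: trace_nonbacktracking.
rewrite E rcons_uniq => /andP[/negP + _]; apply.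
rewrite pE st; elim: (t) => [|i u IH] /=; first by rewrite inE eqxx.
by rewrite inE IH orbT.
Qed.

(** The branch is closed under adjacency, except that it can be left through
    the edge (b, a). *)
Lemma branch_cover a b s y : adj a b -> adj (branch a b s) y -> y != a ->
  exists2 t : word_tree d.-1, adj s t & branch a b t = y.
Proof.
move=> ab sy ya.
have [yE|yE] := eqVneq y (branch_edge a b s).1.
  case: s yE sy => [/= yE|i s /= -> sy]; first by rewrite yE eqxx in ya.
  by exists s => //; apply/word_adjP; right; exists i.
have : y \in forward (branch_edge a b s).1 (branch_edge a b s).2.
  by rewrite in_forward yE sy.
move=> yf.
have yl : (index y (forward (branch_edge a b s).1 (branch_edge a b s).2) < d.-1)%N.
  by rewrite -(card_forward (branch_edge_adj s ab)) index_mem.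
exists (Ordinal yl :: s); first by apply/word_adjP; left; exists (Ordinal yl).
by rewrite /branch /= nth_index.
Qed.

Lemma word_adj_size (s t : word_tree d.-1) : adj s t -> (size t <= (size s).+1)%N.
Proof. by move=> /word_adjP[][i ->] //=; lia. Qed.

Lemma branch_reach a b q : adj a b -> path (@adj T) b q -> a \notin q ->
  exists2 t : word_tree d.-1, branch a b t = last b q & (size t <= size q)%N.
Proof.
move=> ab; elim/last_ind: q => [|q y IH]; first by exists [::].
rewrite rcons_path mem_rcons inE negb_or eq_sym => /andP[bq qy] /andP[ya aq].
have [s sE sq] := IH bq aq.
have [|t st tE] := @branch_cover a b s y ab _ ya; first by rewrite sE.
exists t; rewrite ?last_rcons // size_rcons.
exact: leq_trans (word_adj_size st) _.
Qed.

Lemma branch_down a b s : adj a b -> exists q,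
  [/\ path (@adj T) (branch a b s) q, last (branch a b s) q = b,
      size q = size s &
      forall z, z \in q -> exists2 u, z = branch a b u & (size u <= size s)%N].
Proof.
move=> ab; elim: s => [|i s [q [q1 q2 q3 q4]]]; first by exists [::].
exists (branch a b s :: q); split => //=.
- by rewrite q1 andbT adj_sym branch_cons_adj.
- by rewrite q3.
move=> z; rewrite inE => /orP[/eqP ->|/q4[u -> us]]; first by exists s.
by exists u => //; exact: leqW.
Qed.

Lemma walk_sym x q : path (@adj T) x q -> exists q',
  [/\ path (@adj T) (last x q) q', last (last x q) q' = x & size q' = size q].
Proof.
move=> xq; exists (rev (belast x q)); split.
- by rewrite rev_path; apply: sub_path xq => u v; rewrite adj_sym.
- by case: q {xq} => //= y q; rewrite rev_cons last_rcons.
- by rewrite size_rev size_belast.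
Qed.

(** Removing the last edge (u, v) of a walk from rho cuts the tree into two
    copies of one rooted tree, with roots u and v. The address s' of rho on its
    own side designates, on the other side, a vertex that is near rho: both
    vertices are at distance at most size s from the cut edge. *)
Lemma branch_split a0 rho i (s : word_tree d.-1) : adj a0 rho ->
  let v := branch a0 rho (i :: s) in
  let u := branch a0 rho s in
  adj v u /\ exists s' : word_tree d.-1,
    branch v u s' = rho /\
    exists q, [/\ path (@adj T) rho q, last rho q = branch u v s' &
                  (size q <= (size s).*2.+1)%N].
Proof.
move=> a0r v u; have uv : adj u v by exact: branch_cons_adj.
have vu : adj v u by rewrite adj_sym.
split=> //.
have [q [uq ql qs qin]] := branch_down s a0r.
have vq : v \notin q.
  by apply/negP => /qin[w /(branch_inj a0r) <- /=]; rewrite ltnn.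
have [s' s'E s's] := branch_reach vu uq vq.
exists s'; rewrite s'E; split => //.
have [q1 [p1 l1 e1]] := walk_sym uq.
have [q2 [p2 l2 e2 _]] := branch_down s' uv.
have [q3 [p3 l3 e3]] := walk_sym p2.
rewrite -/u ql in p1 l1; rewrite l2 in p3 l3.
exists (q1 ++ v :: q3); split.
- by rewrite cat_path p1 l1 /= uv.
- by rewrite last_cat l1 /= l3.
- rewrite size_cat /= e3 e2 e1 addnS ltnS -addnn qs leq_add2l -qs; exact: s's.
Qed.

End Branch.

(** * Passage times, embeddings and products *)

Section Walks.
Context (R : realType) (H : sgraph).
Implicit Types (x y : H) (p q : seq H) (w : set H -> R).

Definition nonneg_weight w : Prop := forall e, edge_set H e -> 0 <= w e.

Lemma path_weight_nil w x : path_weight w x [::] = 0.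
Proof. by rewrite /path_weight big_nil. Qed.

Lemma path_weight_cons w x y p :
  path_weight w x (y :: p) = w [set x; y] + path_weight w y p.
Proof. by rewrite /path_weight big_cons. Qed.

Lemma path_weight_cat w x p q :
  path_weight w x (p ++ q) = path_weight w x p + path_weight w (last x p) q.
Proof.
elim: p x => [|y p IH] x /=; first by rewrite path_weight_nil add0r.
by rewrite !path_weight_cons IH addrA.
Qed.

Lemma adj_edge x y : adj x y -> edge_set H [set x; y].
Proof. by move=> xy; exists x, y. Qed.

Lemma path_edges_edge_set x p : path (@adj H) x p ->
  forall e, e \in path_edges x p -> edge_set H e.
Proof.
elim: p x => //= y p IH x /andP[xy yp] e.
by rewrite inE => /orP[/eqP ->|]; [exact: adj_edge|exact: IH].
Qed.

Lemma path_weight_ge0 w x p : nonneg_weight w -> path (@adj H) x p ->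
  0 <= path_weight w x p.
Proof.
move=> w0 xp; rewrite /path_weight big_seq; apply: sumr_ge0 => e.
by move=> /(path_edges_edge_set xp); exact: w0.
Qed.

(** Erasing a loop removes only nonnegative weights. *)
Lemma walk_to_path w x p : nonneg_weight w -> path (@adj H) x p ->
  exists2 q, is_path x (last x p) q & path_weight w x q <= path_weight w x p.
Proof.
move=> w0; elim: p x => [|y p IH] x /=.
  by exists [::]; rewrite // /is_path.
move=> /andP[xy yp]; have [q [yq lq uq] wq] := IH y yp.
have [xin|xin] := boolP (x \in y :: q); last first.
  exists (y :: q); last by rewrite !path_weight_cons lerD2l.
  by split => //=; [rewrite xy|rewrite xin].
have : exists q1 q2, y :: q = q1 ++ x :: q2.
  by case/splitPr: xin => q1 q2; exists q1, q2.
move=> [q1 [q2 E]]; exists q2.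
  split; last by move: uq; rewrite E cat_uniq => /and3P[].
    have : sorted (@adj H) (y :: q) by [].
    by rewrite E => /cat_sorted2 [].
  by rewrite -lq -[last y q]/(last y (y :: q)) E last_cat.
rewrite path_weight_cons (le_trans _ (lerD (lexx _) wq))//.
have yE : path_weight w x (y :: q) = w [set x; y] + path_weight w y q.
  exact: path_weight_cons.
rewrite -yE E path_weight_cat -[leLHS]add0r lerD//.
  apply: path_weight_ge0 => //.
  have : path (@adj H) x (q1 ++ x :: q2) by rewrite -E /= xy.
  by rewrite cat_path => /andP[].
rewrite path_weight_cons lerDr w0 //.
apply: adj_edge.
have : path (@adj H) x (q1 ++ x :: q2) by rewrite -E /= xy.
by rewrite cat_path /= => /and3P[].
Qed.

Lemma fpp_dist_has_lbound w x y : nonneg_weight w ->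
  has_lbound [set path_weight w x p | p in [set p | is_path x y p]].
Proof. by move=> w0; exists 0 => _ [p [xp _ _] <-]; exact: path_weight_ge0. Qed.

Lemma fpp_dist_le w x y p : nonneg_weight w -> path (@adj H) x p ->
  last x p = y -> fpp_dist w x y <= path_weight w x p.
Proof.
move=> w0 xp <-; have [q qP] := walk_to_path w0 xp.
by apply: le_trans; apply: ge_inf; [exact: fpp_dist_has_lbound|exists q].
Qed.

Lemma fpp_dist_ge w x y c : (exists p, is_path x y p) ->
  (forall p, is_path x y p -> c <= path_weight w x p) -> c <= fpp_dist w x y.
Proof.
move=> [p0 p0P] h; apply: lb_le_inf; first by exists (path_weight w x p0), p0.
by move=> _ [p pP <-]; exact: h.
Qed.

Lemma fpp_dist_ge0 w x y : nonneg_weight w -> 0 <= fpp_dist w x y.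
Proof.
move=> w0; have [h|h] := pselect (exists p, is_path x y p).
  by apply: fpp_dist_ge => // p [xp _ _]; exact: path_weight_ge0.
rewrite /fpp_dist (_ : [set _ | _ in _] = set0) ?inf0 //.
by apply/seteqP; split => // c [p pP _]; case: h; exists p.
Qed.

Lemma eq_fpp_dist w w' x y : (forall e, edge_set H e -> w e = w' e) ->
  fpp_dist w x y = fpp_dist w' x y.
Proof.
move=> ww'; rewrite /fpp_dist; congr inf; apply: eq_imagel => p [xp _ _].
rewrite /path_weight !big_seq; apply: eq_bigr => e /(path_edges_edge_set xp).
exact: ww'.
Qed.

End Walks.

Section Embedding.
Context (R : realType) (H H' : sgraph) (phi : H -> H').
Hypothesis phi_inj : injective phi.
Hypothesis phi_hom : forall x y, adj x y -> adj (phi x) (phi y).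
Implicit Types (x y : H) (p q : seq H) (w : set H' -> R).

Definition pullback w : set H -> R := fun e => w (phi @` e).

Lemma image_edge e : edge_set H e -> edge_set H' (phi @` e).
Proof.
move=> [u [v [uv ->]]]; exists (phi u), (phi v); split; first exact: phi_hom.
by rewrite image_setU !image_set1.
Qed.

Lemma pullback_nonneg w : nonneg_weight w -> nonneg_weight (pullback w).
Proof. by move=> w0 e /image_edge; exact: w0. Qed.

Lemma path_weight_map w x p :
  path_weight w (phi x) (map phi p) = path_weight (pullback w) x p.
Proof.
elim: p x => [|y p IH] x /=; first by rewrite !path_weight_nil.
by rewrite !path_weight_cons IH /pullback image_setU !image_set1.
Qed.

Lemma path_hom x p : path (@adj H) x p -> path (@adj H') (phi x) (map phi p).
Proof. by elim: p x => //= y p IH x /andP[/phi_hom -> /IH]. Qed.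

(** The image of a path of the small graph, prolonged by a walk at each end,
    competes in the large graph. *)
Lemma fpp_dist_detour w (x' y' : H') (p q : seq H') x y : nonneg_weight w ->
  (exists p, is_path x y p) ->
  path (@adj H') x' p -> last x' p = phi x ->
  path (@adj H') (phi y) q -> last (phi y) q = y' ->
  fpp_dist w x' y' <=
    path_weight w x' p + fpp_dist (pullback w) x y + path_weight w (phi y) q.
Proof.
move=> w0 xy x'p lp yq lq.
rewrite -lerBlDr -lerBlDl; apply: fpp_dist_ge => // s [xs ls _].
rewrite lerBlDl lerBlDr.
have ls' : last (phi x) (map phi s) = phi y by rewrite last_map ls.
apply: (@le_trans _ _ (path_weight w x' (p ++ map phi s ++ q))).
  apply: fpp_dist_le => //.
    by rewrite !cat_path x'p lp ls' yq path_hom.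
  by rewrite !last_cat lp ls'.
by rewrite !path_weight_cat lp ls' addrA path_weight_map.
Qed.

Lemma fpp_dist_embed w x y : nonneg_weight w -> (exists p, is_path x y p) ->
  fpp_dist w (phi x) (phi y) <= fpp_dist (pullback w) x y.
Proof.
move=> w0 xy; apply: le_trans (fpp_dist_detour (p := [::]) (q := [::]) w0 xy _ _ _ _) _ => //.
by rewrite !path_weight_nil add0r addr0.
Qed.

(** When a minimizing path runs inside the image, the distance is that of the
    pulled back weights. *)
Lemma fpp_dist_lift w x y p : nonneg_weight w -> path (@adj H) x p ->
  is_minimizing w (phi x) (phi y) (map phi p) ->
  fpp_dist (pullback w) x y <= fpp_dist w (phi x) (phi y).
Proof.
move=> w0 xp [[_ + _] <-]; rewrite last_map => /phi_inj lp.
rewrite path_weight_map; apply: fpp_dist_le => //; exact: pullback_nonneg.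
Qed.

End Embedding.

Lemma prod_adjP (T G : sgraph) (a b : cartesian_product T G) : adj a b <->
  (a.1 = b.1 /\ adj a.2 b.2) \/ (a.2 = b.2 /\ adj a.1 b.1).
Proof.
rewrite {1}/adj /= /prod_adj; split.
  by move=> /orP[/andP[/eqP]|/andP[/eqP]]; [left|right].
by move=> [[-> ->]|[-> ->]]; rewrite eqxx ?orbT.
Qed.

Section ProductEmbedding.
Variables (W T G : sgraph) (phi : W -> T).
Hypothesis phi_inj : injective phi.
Hypothesis phi_hom : forall x y, adj x y -> adj (phi x) (phi y).

Definition prod_embed (x : cartesian_product W G) : cartesian_product T G :=
  (phi x.1, x.2).

Lemma prod_embed_inj : injective prod_embed.
Proof. by move=> [s g] [t h] [/phi_inj -> ->]. Qed.

Lemma prod_embed_hom x y : adj x y -> adj (prod_embed x) (prod_embed y).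
Proof.
move=> /prod_adjP xy; apply/prod_adjP => /=.
by case: xy => -[-> h]; [left|right]; split => //; exact: phi_hom.
Qed.

(** If the image of phi can be left only through a, a path of the product that
    never stands over a stays over the image. *)
Lemma prod_path_lift (a : T) :
  (forall s y, adj (phi s) y -> y != a -> exists2 t, adj s t & phi t = y) ->
  forall (p : seq (cartesian_product T G)) (x : cartesian_product W G),
    path (@adj (cartesian_product T G)) (prod_embed x) p -> a \notin map fst p ->
    exists2 q, map prod_embed q = p & path (@adj (cartesian_product W G)) x q.
Proof.
move=> cover; elim=> [|[y h] p IH] [s g]; first by exists [::].
rewrite /= inE negb_or eq_sym => /andP[/prod_adjP xy yp] /andP[ya ap].
have [t tE st] : exists2 t : cartesian_product W G,
    prod_embed t = (y, h) & @adj (cartesian_product W G) (s, g) t.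
  case: xy => /= -[E1 E2].
    by exists (s, h); [rewrite /prod_embed /= E1|apply/prod_adjP; left].
  have [t st tE] := cover _ _ E2 ya.
  by exists (t, h); [rewrite /prod_embed /= tE|apply/prod_adjP; right].
rewrite -tE in yp; have [q qE tq] := IH t yp ap.
exists (t :: q); first by rewrite /= qE tE.
by apply/andP.
Qed.

End ProductEmbedding.

Section Levels.
Variables (T G : sgraph).
Local Notation TG := (cartesian_product T G).

Lemma path_at_level (g : G) (x : T) q : path (@adj T) x q ->
  path (@adj TG) (x, g) [seq (y, g) | y <- q].
Proof.
elim: q x => //= y q IH x /andP[xy yq]; rewrite IH // andbT.
by apply/prod_adjP; right.
Qed.

Variable r : nat -> G.
Hypothesis hr : is_ray r.

Definition ray_path (x : T) n : seq TG := [seq (x, r j) | j <- iota 1 n].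

Lemma ray_adj x j : @adj TG (x, r j) (x, r j.+1).
Proof. by apply/prod_adjP; left; split => //; exact: hr.2. Qed.

Lemma ray_is_path x n : is_path ((x, r 0%N) : TG) (x, r n) (ray_path x n).
Proof.
split.
- rewrite /ray_path; elim: n 0%N => //= n IH j; rewrite IH andbT.
  exact: ray_adj.
- by rewrite /ray_path last_map -[0%N]/(0%N) -nth_last size_iota;
    case: n => // n; rewrite nth_iota.
- rewrite /ray_path -(map_cons (fun j => (x, r j)) 0%N) map_inj_uniq.
    by rewrite -[0%N :: _]/(iota 0 n.+1) iota_uniq.
  by move=> i j [] /(hr.1).
Qed.

Lemma size_ray_path x n : size (ray_path x n) = n.
Proof. by rewrite size_map size_iota. Qed.

End Levels.

(** * Measurability of passage times *)

Section Measurability.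
Context (dO : measure_display) (Omega : measurableType dO) (R : realType).

Lemma measurable_inf_countable (I : Type) (S : set I) (h : I -> Omega -> R) :
  countable S -> (forall i, S i -> measurable_fun setT (h i)) ->
  (forall t, has_lbound [set h i t | i in S]) ->
  measurable_fun setT (fun t => inf [set h i t | i in S]).
Proof.
move=> cS mh lb; have [->|[f]] := pfcard_geP cS.
  by apply: (eq_measurable_fun (cst 0 : Omega -> R)) => // t _ /=; rewrite image_set0 inf0.
apply: (eq_measurable_fun (fun t => infs (fun n => h (f n) t) 0%N)).
  move=> t _; rewrite /infs /sdrop; congr inf; apply/seteqP; split => x /=.
    by move=> [n _ <-]; exists (f n) => //; exact: funS.
  move=> [i Si <-]; by have [n _ <-] := @surj _ _ _ _ f i Si; exists n.
apply: measurable_fun_infs => [t _|n].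
  have [c cP] := lb t; exists c => _ [n _ <-]; apply: cP.
  by exists (f n) => //; exact: funS.
by apply: mh; exact: funS.
Qed.

Lemma countable_walks (H : sgraph) (hH : locally_countable H) (x : H) :
  countable [set p | path (@adj H) x p].
Proof.
rewrite (_ : [set _ | _] =
    \bigcup_n [set p | path (@adj H) x p /\ size p = n]); last first.
  by apply/seteqP; split => p //= => [xp|[n _ []]//]; exists (size p).
apply: bigcup_countable => // n _.
elim: n x => [|n IH] x.
  apply: (@sub_countable _ _ _ [set [::]]) => //.
  by apply: subset_card_le => p /= [_ /size0nil ->].
apply: (@sub_countable _ _ _ (\bigcup_(y in [set y | adj x y])
   (cons y @` [set p | path (@adj H) y p /\ size p = n]))).
  apply: subset_card_le => -[|y p] /=; first by case.
  move=> [/andP[xy yp] [sp]].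
  by exists y => //; exists p.
apply: bigcup_countable => // y _.
by apply: (@sub_countable _ _ _ [set p | path (@adj H) y p /\ size p = n]) => //;
   exact: card_image_le.
Qed.

Lemma measurable_path_weight (H : sgraph) (w : Omega -> set H -> R) x p :
  (forall e, edge_set H e -> measurable_fun setT (w ^~ e)) ->
  path (@adj H) x p -> measurable_fun setT (fun t => path_weight (w t) x p).
Proof.
move=> mw; elim: p x => [|y p IH] x /=.
  move=> _; apply: (eq_measurable_fun (cst 0 : Omega -> R)) => // t _ /=.
  by rewrite path_weight_nil.
move=> /andP[xy yp].
apply: (eq_measurable_fun (fun t => w t [set x; y] + path_weight (w t) y p)).
  by move=> t _; rewrite path_weight_cons.
apply: measurable_funD; last exact: IH.
by apply: mw; exact: adj_edge.
Qed.

Lemma measurable_fpp_dist (H : sgraph) (hH : locally_countable H)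
    (w : Omega -> set H -> R) x y :
  (forall e, edge_set H e -> measurable_fun setT (w ^~ e)) ->
  (forall t, nonneg_weight (w t)) ->
  measurable_fun setT (fun t => fpp_dist (w t) x y).
Proof.
move=> mw w0; apply: measurable_inf_countable.
- apply: (@sub_countable _ _ _ [set p | path (@adj H) x p]).
    by apply: subset_card_le => p [].
  exact: countable_walks.
- by move=> p [xp _ _]; exact: measurable_path_weight.
- by move=> t; exact: fpp_dist_has_lbound.
Qed.

End Measurability.

Lemma locally_countable_product (T G : sgraph) :
  locally_countable T -> locally_countable G ->
  locally_countable (cartesian_product T G).
Proof.
move=> cT cG [x g]; apply: (@sub_countable _ _ _
  ((pair x @` [set h | adj g h]) `|` ((fun y => (y, g)) @` [set y | adj x y]))).
  apply: subset_card_le => -[y h] /prod_adjP /= [[<- gh]|[<- xy]].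
    by left; exists h.
  by right; exists y.
rewrite -bigcup2E; apply: bigcup_countable => // -[|[|n]] _ /=.
- by apply: (@sub_countable _ _ _ [set h | adj g h]) => //; exact: card_image_le.
- by apply: (@sub_countable _ _ _ [set y | adj x y]) => //; exact: card_image_le.
- exact: countable0.
Qed.

(** * Independent blocks of weights *)

Section Cylinders.
Import numFieldTopology.Exports.
Context (R : realType) (I : choiceType) (A : set I).
Implicit Types (s : {fset I}) (B : I -> set R).

Definition cylinder s B : set (I -> R) := [set z | forall i, i \in s -> B i (z i)].

Definition cylinders : set (set (I -> R)) :=
  [set S | exists s B, [/\ [set` s] `<=` A, forall i, measurable (B i) &
                           S = cylinder s B]].

(** The sigma-algebra sees only the coordinates in A. *)
Definition weight_space := g_sigma_algebraType cylinders.
HB.instance Definition _ := Measurable.on weight_space.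

Lemma cylindersT : cylinders setT.
Proof.
exists fset0, (fun=> setT); split => //.
by apply/seteqP; split => // z _ i _.
Qed.

Lemma cylinders_setI : setI_closed cylinders.
Proof.
move=> _ _ [s [B [sA mB ->]]] [t [C [tA mC ->]]].
exists (s `|` t)%fset.
exists (fun i => (if i \in s then B i else setT) `&` (if i \in t then C i else setT)).
split.
- by move=> i /=; rewrite in_fsetU => /orP[/sA|/tA].
- by move=> i; apply: measurableI; case: ifP.
apply/seteqP; split => z /=.
  by move=> [zB zC] i _; split; case: ifP => //; [exact: zB|exact: zC].
move=> zBC; split => i iin.
  by have [] := zBC i; rewrite ?in_fsetU ?iin.
by have [] := zBC i; rewrite ?in_fsetU iin ?orbT.
Qed.

Lemma cylinder_preimage (T : Type) (Z : T -> I -> R) s B :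
  Z @^-1` cylinder s B = \bigcap_(i in [set` s]) ((Z ^~ i) @^-1` B i).
Proof. by []. Qed.

Lemma measurable_weight_space d (T : measurableType d) (Z : T -> weight_space) :
  (forall i, A i -> measurable_fun setT (fun t => Z t i)) ->
  measurable_fun setT Z.
Proof.
move=> mZ; pose proof (@measurability _ _ T weight_space setT Z cylinders erefl) as K; apply: K.
move=> _ [_ [s [B [sA mB ->]]] <-]; rewrite setTI cylinder_preimage.
apply: fin_bigcap_measurable => // i si.
rewrite -[X in measurable X]setTI; apply: mZ => //; exact: sA.
Qed.

Lemma measurable_coord i : A i -> measurable_fun setT (fun z : weight_space => z i).
Proof.
move=> Ai _ B mB; rewrite setTI; apply: sub_sigma_algebra.
exists [fset i]%fset, (fun=> B); split => //.
  by move=> j /=; rewrite inE => /eqP ->.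
apply/seteqP; split => z /=; first by move=> Bz j; rewrite inE => /eqP ->.
by apply; rewrite inE.
Qed.

(** Cylinders are stable under intersection, so that the pi-lambda theorem
    applies. *)
Lemma cylinder_unique (m1 m2 : {measure set weight_space -> \bar R}) :
  (forall S, cylinders S -> m1 S = m2 S) -> (m1 setT < +oo)%E ->
  forall S, measurable S -> m1 S = m2 S.
Proof.
move=> m12 m1T; apply: (@measure_unique _ R weight_space cylinders (fun=> setT)
  erefl cylinders_setI (fun=> cylindersT) _ m1 m2 m12 (fun=> m1T)).
by apply/seteqP; split => // z _; exists 0%N.
Qed.

Context dO (Omega : measurableType dO) (P : probability Omega R).

Lemma same_law_cylinders (Z Z' : Omega -> weight_space) :
  measurable_fun setT Z -> measurable_fun setT Z' ->
  (forall S, cylinders S -> P (Z @^-1` S) = P (Z' @^-1` S)) ->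
  forall S, measurable S -> P (Z @^-1` S) = P (Z' @^-1` S).
Proof.
move=> mZ mZ' ZZ' S mS.
pose m1 := measure_function_pushforward__canonical__measure_function_Measure P mZ.
pose m2 := measure_function_pushforward__canonical__measure_function_Measure P mZ'.
apply: (@cylinder_unique m1 m2) => //=.
rewrite /pushforward preimage_setT; exact: le_lt_trans (probability_le1 _ _) (ltry _).
Qed.

(** As functions of S, both sides are finite measures. *)
Lemma indep_cylinders (Z : Omega -> weight_space) (C : set Omega) :
  measurable_fun setT Z -> measurable C ->
  (forall S, cylinders S -> P (Z @^-1` S `&` C) = (P C * P (Z @^-1` S))%E) ->
  forall S, measurable S -> P (Z @^-1` S `&` C) = (P C * P (Z @^-1` S))%E.
Proof.
move=> mZ mC ZC S mS.
pose m1 := measure_function_pushforward__canonical__measure_function_Measure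
  (mrestr P mC) mZ.
pose m := measure_function_pushforward__canonical__measure_function_Measure P mZ.
have PC0 : 0 <= fine (P C) by exact: fine_ge0.
pose m2 := mscale (NngNum PC0) m.
have h U : m2 U = (P C * P (Z @^-1` U))%E.
  by rewrite /m2 /mscale /= fineK // fin_num_measure.
rewrite -h; apply: (@cylinder_unique m1 m2) => //.
  by move=> U /ZC ZU; exact: etrans ZU (esym (h U)).
rewrite /= /pushforward preimage_setT /mrestr setTI.
exact: le_lt_trans (probability_le1 _ _) (ltry _).
Qed.

End Cylinders.

Section IndependentBlocks.
Import numFieldTopology.Exports.
Context (R : realType) dO (Omega : measurableType dO) (P : probability Omega R).
Context dO' (Omega' : measurableType dO') (Q : probability Omega' R).
Context (X0 : {RV Q >-> R}) (I J : choiceType) (A : set I) (E : set J).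
Variables (X : J -> {RV P >-> R}) (a b : I -> J) (a' b' : J -> I).
Hypothesis hX : mutually_independent E X.
Hypothesis hlaw : forall e, E e -> same_law (X e) X0.
Hypotheses (aK : cancel a a') (bK : cancel b b').
Hypothesis aE : forall i, A i -> E (a i).
Hypothesis bE : forall i, A i -> E (b i).
Hypothesis abD : forall i j, A i -> A j -> a i <> b j.

Definition block (c : I -> J) (w : Omega) : weight_space R A := fun i => X (c i) w.

(** The two cylinders constrain finitely many weights, all of them distinct
    since a and b are injective with disjoint images on A. *)
Lemma block_cylinders (s t : {fset I}) (B C : I -> set R) :
  [set` s] `<=` A -> [set` t] `<=` A ->
  (forall i, measurable (B i)) -> (forall i, measurable (C i)) ->
  P (block a @^-1` cylinder s B `&` block b @^-1` cylinder t C) =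
  (\prod_(i <- s) Q (X0 @^-1` B i) * \prod_(i <- t) Q (X0 @^-1` C i))%E.
Proof.
move=> sA tA mB mC.
pose u := [fset j | j in map a s ++ map b t]%fset.
pose D j := if j \in map a s then B (a' j) else C (b' j).
have Da i : i \in s -> D (a i) = B i by move=> si; rewrite /D map_f // aK.
have Db i : i \in t -> D (b i) = C i.
  move=> ti; rewrite /D; case: ifP; last by rewrite bK.
  by move=> /mapP[j js /esym/abD]; case; [exact: sA|exact: tA].
have uP : perm_eq u (map a s ++ map b t).
  apply: uniq_perm; first exact: fset_uniq.
    rewrite cat_uniq !map_inj_uniq ?fset_uniq ?andbT /=; [|exact: can_inj..].
    apply/hasPn => _ /mapP[i ti ->]; apply/mapP => -[j js /esym/abD].
    by case; [exact: sA|exact: tA].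
  by move=> j; rewrite in_fset.
have uE : [set` u] `<=` E.
  move=> j /=; rewrite in_fset mem_cat => /orP[]/mapP[i iin ->].
    by apply: aE; exact: sA.
  by apply: bE; exact: tA.
have mD j : measurable (D j) by rewrite /D; case: ifP.
transitivity (P (\bigcap_(j in [set` u]) (X j @^-1` D j))).
  congr (P _); apply/seteqP; split => w /=.
    move=> [wB wC] j /=; rewrite in_fset mem_cat => /orP[]/mapP[i iin ->].
      by rewrite Da //; exact: wB.
    by rewrite Db //; exact: wC.
  move=> wD; split => i iin.
    by rewrite -Da //; apply: wD; rewrite /= in_fset mem_cat map_f.
  by rewrite -Db //; apply: wD; rewrite /= in_fset mem_cat map_f ?orbT.
rewrite hX // (perm_big _ uP) /= big_cat /= !big_map; congr (_ * _)%E.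
  rewrite !big_seq; apply: eq_bigr => i si.
  by rewrite Da //; apply: hlaw => //; apply: aE; exact: sA.
rewrite !big_seq; apply: eq_bigr => i ti.
by rewrite Db //; apply: hlaw => //; apply: bE; exact: tA.
Qed.

Let cylinder0 : @cylinder R I fset0 (fun=> setT) = setT.
Proof. by apply/seteqP; split => // z _ i _. Qed.

Let sub0 : [set` (fset0 : {fset I})] `<=` A.
Proof. by move=> i /=; rewrite inE. Qed.

Lemma block_cylinder_a (s : {fset I}) (B : I -> set R) : [set` s] `<=` A ->
  (forall i, measurable (B i)) ->
  P (block a @^-1` cylinder s B) = (\prod_(i <- s) Q (X0 @^-1` B i))%E.
Proof.
move=> sA mB; have := block_cylinders sA sub0 mB (fun=> measurableT).
by rewrite cylinder0 preimage_setT setIT big_nil mule1.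
Qed.

Lemma block_cylinder_b (s : {fset I}) (B : I -> set R) : [set` s] `<=` A ->
  (forall i, measurable (B i)) ->
  P (block b @^-1` cylinder s B) = (\prod_(i <- s) Q (X0 @^-1` B i))%E.
Proof.
move=> sA mB; have := block_cylinders sub0 sA (fun=> measurableT) mB.
by rewrite cylinder0 preimage_setT setTI big_nil mul1e.
Qed.

Lemma measurable_block c : measurable_fun setT (block c).
Proof. by apply: measurable_weight_space => i Ai; exact: measurable_funPT. Qed.

Lemma block_law (S : set (weight_space R A)) : measurable S ->
  P (block a @^-1` S) = P (block b @^-1` S).
Proof.
apply: same_law_cylinders; [exact: measurable_block..|].
move=> _ [s [B [sA mB ->]]].
by rewrite block_cylinder_a // block_cylinder_b.
Qed.

(** Independence passes from cylinders to the generated sigma-algebra in one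
    argument at a time. *)
Lemma block_indep (S S' : set (weight_space R A)) : measurable S -> measurable S' ->
  P (block a @^-1` S `&` block b @^-1` S') =
  (P (block a @^-1` S) * P (block b @^-1` S'))%E.
Proof.
move=> mS mS'; have mpre c U : measurable U -> measurable (block c @^-1` U).
  by move=> mU; rewrite -[X in measurable X]setTI; exact: measurable_block.
rewrite muleC; apply: indep_cylinders => //; [exact: measurable_block|exact: mpre|].
move=> _ [s [B [sA mB ->]]]; rewrite setIC muleC.
have mcyl : measurable (cylinder s B : set (weight_space R A)).
  by apply: sub_sigma_algebra; exists s, B.
apply: indep_cylinders mS' => //; [exact: measurable_block|exact: mpre|].
move=> _ [t [C [tA mC ->]]]; rewrite setIC block_cylinders //.
by rewrite block_cylinder_a // block_cylinder_b.
Qed.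

End IndependentBlocks.

(** * Mean deviations *)

Section MeanDeviation.
Context (R : realType) dO (Omega : measurableType dO) (P : probability Omega R).
Implicit Types f g h : Omega -> R.
Local Notation integrable f := (P.-integrable setT (EFin \o f)).

Lemma integrable_addR f g : integrable f -> integrable g ->
  integrable (fun w => f w + g w).
Proof.
move=> fi gi; rewrite (_ : _ \o _ = (EFin \o f) \+ (EFin \o g))%E //.
exact: integrableD.
Qed.

Lemma integrable_subR f g : integrable f -> integrable g ->
  integrable (fun w => f w - g w).
Proof.
move=> fi gi; rewrite (_ : _ \o _ = (EFin \o f) \- (EFin \o g))%E //.
exact: integrableB.
Qed.

Lemma integrable_cst (c : R) : integrable (cst c).
Proof. exact: finite_measure_integrable_cst. Qed.

Lemma integrable_normR f : integrable f -> integrable (fun w => `|f w|).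
Proof. by move=> fi; exact: (integrable_abse fi). Qed.

Lemma integrable_le f g : measurable_fun setT f ->
  (forall w, 0 <= f w <= g w) -> integrable g -> integrable f.
Proof.
move=> mf fg; apply: le_integrable => //; first exact/measurable_EFinP.
by move=> w _; have /andP[f0 fw] := fg w; rewrite lee_fin !ger0_norm // (le_trans f0).
Qed.

Lemma integrable_measurable f : integrable f -> measurable_fun setT f.
Proof. by move=> /integrableP[/measurable_EFinP]. Qed.

Lemma integrable_indic_set (V : set Omega) : measurable V ->
  integrable (\1_V : Omega -> R).
Proof.
move=> mV; apply: (@integrable_le _ (cst 1)); first exact: measurable_indic.
  by move=> w; rewrite indicE; case: (_ \in _); rewrite ?lexx ?ler01.
exact: integrable_cst.
Qed.

Lemma Rintegral_indic_set (V : set Omega) : measurable V ->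
  \int[P]_w \1_V w = fine (P V).
Proof. by move=> mV; rewrite /Rintegral integral_indic // setIT. Qed.

Lemma integrable_scaleR (c : R) f : integrable f -> integrable (fun w => c * f w).
Proof.
move=> fi; rewrite (_ : _ \o _ = (fun w => c%:E * (f w)%:E))%E //.
exact: (@integrableZl _ _ _ P _ measurableT c _ fi).
Qed.

Ltac integrability := repeat first [assumption | exact: integrable_cst |
  apply: integrable_subR | apply: integrable_addR | apply: integrable_normR].

Lemma le_RintegralT f g : integrable f -> integrable g ->
  (forall w, f w <= g w) -> \int[P]_w f w <= \int[P]_w g w.
Proof. by move=> fi gi fg; apply: le_Rintegral => // w _; exact: fg. Qed.

Lemma RintegralT_cst (c : R) : \int[P]_w c = c.
Proof.
rewrite (Rintegral_cst _ measurableT) -[RHS]mulr1; congr (_ * _).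
by rewrite [X in fine X](@probability_setT _ _ _ P).
Qed.

Lemma Rintegral_same_law f g : integrable f -> integrable g ->
  (forall B, measurable B -> P (f @^-1` B) = P (g @^-1` B)) ->
  \int[P]_w f w = \int[P]_w g w.
Proof.
move=> fi gi fg; congr fine.
have mf := integrable_measurable fi; have mg := integrable_measurable gi.
transitivity (\int[pushforward P f]_y y%:E)%E.
  by rewrite integral_pushforward // preimage_setT.
transitivity (\int[pushforward P g]_y y%:E)%E; last first.
  by rewrite integral_pushforward // preimage_setT.
pose m1 := measure_function_pushforward__canonical__measure_function_Measure P mf.
pose m2 := measure_function_pushforward__canonical__measure_function_Measure P mg.
by apply: (@eq_measure_integral _ _ _ _ m2 m1) => B mB _; exact: fg.
Qed.

(** By independence the law of (f, g) is a product, so that one can integrate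
    g out first; the triangle inequality moves that integral inside. *)
Lemma indep_mean_deviation f g : integrable f -> integrable g ->
  (forall B C, measurable B -> measurable C ->
     P (f @^-1` B `&` g @^-1` C) = (P (f @^-1` B) * P (g @^-1` C))%E) ->
  \int[P]_w `|f w - \int[P]_u g u| <= \int[P]_w `|f w - g w|.
Proof.
move=> fi gi fg.
have mf := integrable_measurable fi; have mg := integrable_measurable gi.
pose F : {mfun Omega >-> R} := HB.pack f (isMeasurableFun.Build _ _ _ _ _ mf).
pose G : {mfun Omega >-> R} := HB.pack g (isMeasurableFun.Build _ _ _ _ _ mg).
pose m1 : probability R R := distribution P F.
pose m2 : probability R R := distribution P G.
have mfgp : measurable_fun setT (fun w => (f w, g w)) by exact: measurable_fun_pair.
pose m := measure_function_pushforward__canonical__measure_function_Measure P mfgp.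
have mE : forall X, measurable X -> (m1 \x m2)%E X = m X.
  by apply: product_measure_unique => B C mB mC; exact: fg.
pose k (z : R * R) : \bar R := `|z.1 - z.2|%:E.
have mk : measurable_fun setT k.
  apply/measurable_EFinP; apply: measurableT_comp => //.
  by apply: measurable_funB; [exact: measurable_fst|exact: measurable_snd].
have k0 z : (0 <= k z)%E by rewrite lee_fin.
have g2i : m2.-integrable setT EFin.
  apply: integrable_pushforward => //; exact: measurable_id.
have g2E : (\int[m2]_y y%:E = \int[P]_w (g w)%:E)%E.
  by rewrite integral_distribution.
have E1 : (\int[P]_w `|f w - g w|%:E = \int[m1]_x \int[m2]_y k (x, y))%E.
  rewrite -(fubini_tonelli1 k) //.
  transitivity (\int[m]_z k z)%E; last first.
    by apply: eq_measure_integral => X mX _; rewrite /= mE.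
  by rewrite ge0_integral_pushforward // preimage_setT.
set c := \int[P]_u g u.
have cE : (c%:E = \int[m2]_y y%:E)%E.
  by rewrite g2E /c fineK //; exact: integrable_fin_num.
pose q (x : R) : \bar R := `|x - c|%:E.
have mq : measurable_fun setT q.
  apply/measurable_EFinP; apply: measurableT_comp => //.
  by apply: measurable_funB.
have E2 : (\int[P]_w `|f w - c|%:E = \int[m1]_x q x)%E.
  by rewrite (ge0_integral_distribution F) // => x; rewrite lee_fin.
have fci : integrable (fun w => `|f w - c|).
  by apply: integrable_normR; apply: integrable_subR => //; exact: integrable_cst.
have fgi : integrable (fun w => `|f w - g w|).
  by apply: integrable_normR; exact: integrable_subR.
apply: fine_le; [exact: integrable_fin_num..|].
rewrite E1 E2; apply: ge0_le_integral => //.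
- by move=> x _; rewrite lee_fin.
- exact: measurable_fun_fubini_tonelli_F.
move=> x _; rewrite /q.
have xi : m2.-integrable setT (cst x%:E) by exact: finite_measure_integrable_cst.
have -> : (`|x - c|%:E = `|\int[m2]_y (x%:E - y%:E)|)%E.
  rewrite (integralB measurableT xi g2i) integral_cst //.
  by rewrite [X in (_ * X - _)%E](_ : _ = 1%E) ?mule1 -?cE //; exact: (probability_setT m2).
apply: le_trans (le_abse_integral _ _ _) _ => //.
by apply: emeasurable_funB => //; exact/measurable_EFinP.
Qed.

(** Sandwich: D lies below f and below g up to c, the copies f and g have the
    same mean, and independence turns their distance into a deviation from the
    mean. *)
Lemma mean_deviation_le f g h (D : Omega -> R) (delta : R) :
  integrable f -> integrable g -> integrable h -> integrable D ->
  (forall w, D w <= f w) -> (forall w, D w <= g w + h w) -> (forall w, 0 <= h w) ->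
  \int[P]_w f w = \int[P]_w g w ->
  \int[P]_w f w - \int[P]_w D w <= delta ->
  \int[P]_w `|f w - \int[P]_u g u| <= \int[P]_w `|f w - g w| ->
  \int[P]_w `|D w - \int[P]_u D u| <= 4 * delta + 2 * \int[P]_w h w.
Proof.
move=> fi gi hi Di Df Dg h0 Efg Edelta Eind.
set ED := \int[P]_u D u in Edelta *; set Ef := \int[P]_w f w in Edelta Efg *.
have EfD : ED <= Ef by exact: le_RintegralT.
(* |f - g| <= (f - D) + (g - D + h) + h, and g has the mean of f. *)
have B1 : \int[P]_w `|f w - g w| <= 2 * delta + 2 * \int[P]_w h w.
  apply: (@le_trans _ _ (\int[P]_w ((f w - D w) + (g w - D w + (h w + h w))))).
    apply: le_RintegralT; [by integrability..|].
    move=> w; have := Df w; have := Dg w; have := h0 w.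
    by rewrite ler_norml; lra.
  rewrite RintegralD //; [|by integrability..].
  rewrite (RintegralB measurableT fi Di) RintegralD //; [|by integrability..].
  rewrite (RintegralB measurableT gi Di) RintegralD // -Efg -/ED -/Ef; lra.
(* |D - ED| <= |D - f| + |f - Ef| + |Ef - ED| *)
apply: (@le_trans _ _ (\int[P]_w ((f w - D w) + (`|f w - Ef| + (Ef - ED))))).
  apply: le_RintegralT; [by integrability..|].
  move=> w; have := Df w; have := ler_norm (f w - Ef); have := ler_norm (- (f w - Ef)).
  by rewrite normrN ler_norml; lra.
rewrite RintegralD //; [|by integrability..].
rewrite (RintegralB measurableT fi Di) RintegralD //; [|by integrability..].
rewrite RintegralT_cst -/ED -/Ef.
rewrite -Efg in Eind; lra.
Qed.

(** Truncation: f is at most t where f <= t, and at most t^(-eps) f^(1+eps)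
    elsewhere. *)
Lemma Rintegral_indic_le f (V : set Omega) (eps t : R) : measurable V ->
  (forall w, 0 <= f w) -> 0 < eps -> 0 < t ->
  integrable f -> integrable (fun w => f w `^ (1 + eps)) ->
  \int[P]_w (f w * \1_V w) <=
    t * fine (P V) + t `^ (- eps) * \int[P]_w (f w `^ (1 + eps)).
Proof.
move=> mV f0 eps0 t0 fi fei.
have mf := integrable_measurable fi.
have m1 : measurable_fun setT (\1_V : Omega -> R) by exact: measurable_indic.
have Vi := integrable_indic_set mV.
have i1 : integrable (fun w => t * \1_V w) by exact: integrable_scaleR.
have i2 : integrable (fun w => t `^ (- eps) * f w `^ (1 + eps)).
  exact: integrable_scaleR.
apply: (@le_trans _ _ (\int[P]_w (t * \1_V w + t `^ (- eps) * f w `^ (1 + eps)))).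
  apply: le_RintegralT.
  - apply: (@integrable_le _ f) => //; first exact: measurable_funM.
    move=> w; rewrite indicE; case: (_ \in _); rewrite ?mulr1 ?mulr0 f0 ?lexx //.
  - exact: integrable_addR.
  move=> w; have [ft|tf] := lerP (f w) t.
    rewrite -[leLHS]addr0 lerD ?mulr_ge0 ?powR_ge0 //.
    by rewrite ler_wpM2r // indicE.
  apply: (@le_trans _ _ (f w)).
    by rewrite indicE; case: (_ \in _); rewrite ?mulr1 ?mulr0.
  rewrite -[leLHS]add0r lerD //.
    by rewrite mulr_ge0 // ltW.
  have fw0 : 0 < f w by exact: lt_trans tf.
  rewrite powRD; last by rewrite (gt_eqF fw0) implybT.
  rewrite powRr1; last exact: ltW.
  rewrite mulrCA ler_peMr // ?(ltW fw0) // powRN mulrC ler_pdivlMr ?powR_gt0 // mul1r.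
  by apply: ge0_ler_powR; rewrite ?nnegrE ltW.
rewrite RintegralD // !RintegralZl // lerD2r ler_wpM2l ?(ltW t0) //.
by rewrite Rintegral_indic_set.
Qed.

Lemma measurable_norm_gt f (c : R) : measurable_fun setT f ->
  measurable [set w | c < `|f w|].
Proof.
move=> mf; have mnf : measurable_fun setT (fun w => `|f w|) by exact: measurableT_comp.
have := mnf measurableT _ (measurable_itv `]c, +oo[).
rewrite setTI; congr measurable; apply/seteqP; split => w /=;
  by rewrite in_itv /= andbT.
Qed.

Lemma markov_Rintegral f (c : R) : 0 < c -> integrable f ->
  c * fine (P [set w | c < `|f w|]) <= \int[P]_w `|f w|.
Proof.
move=> c0 fi; have mA := measurable_norm_gt c (integrable_measurable fi).
rewrite -Rintegral_indic_set // -RintegralZl //; last exact: integrable_indic_set.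
apply: le_RintegralT.
- by apply: integrable_scaleR; exact: integrable_indic_set.
- exact: integrable_normR.
move=> w; rewrite indicE; have [|] := boolP (w \in _); last by rewrite mulr0.
by rewrite inE mulr1 => /ltW.
Qed.

End MeanDeviation.

(** * Means of path weights and visits of a random path *)

Section EdgeWeights.
Context (R : realType) (H : sgraph).
Context dO' (Omega' : measurableType dO') (Q : probability Omega' R).
Context (X0 : {RV Q >-> R}) dO (Omega : measurableType dO) (P : probability Omega R).
Variable X : set H -> {RV P >-> R}.
Hypothesis X0_ge0 : forall w, 0 <= X0 w.
Hypothesis X0_mean : ('E_Q[X0] < +oo)%E.
Hypothesis X_law : forall e, edge_set H e -> same_law (X e) X0.
Hypothesis X_ge0 : forall e w, edge_set H e -> 0 <= X e w.
Local Notation integrable f := (P.-integrable setT (EFin \o f)).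

Let mean : R := \int[Q]_w X0 w.

Lemma weight_transfer (phi : R -> R) e : edge_set H e ->
  measurable_fun setT phi -> (forall x, 0 <= phi x) ->
  (\int[P]_w (phi (X e w))%:E = \int[Q]_w (phi (X0 w))%:E)%E.
Proof.
move=> He mphi phi0.
have mE : measurable_fun setT (EFin \o phi) by exact/measurable_EFinP.
rewrite -(ge0_integral_distribution (X e) mE); last by move=> x; rewrite lee_fin.
rewrite -(ge0_integral_distribution X0 mE); last by move=> x; rewrite lee_fin.
by apply: eq_measure_integral => B mB _; exact: X_law.
Qed.

Lemma weight_integrable (phi : R -> R) e : edge_set H e ->
  measurable_fun setT phi -> (forall x, 0 <= phi x) ->
  (\int[Q]_w (phi (X0 w))%:E < +oo)%E -> integrable (fun w => phi (X e w)).
Proof.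
move=> He mphi phi0 fin; apply/integrableP; split.
  by apply/measurable_EFinP; exact: measurableT_comp.
under eq_integral do rewrite /= ger0_norm //.
by rewrite weight_transfer.
Qed.

Let mean_norm : (\int[Q]_w (`|X0 w|)%:E = \int[Q]_w (X0 w)%:E)%E.
Proof. by apply: eq_integral => w _; rewrite ger0_norm. Qed.

Lemma edge_integrable e : edge_set H e -> integrable (X e).
Proof.
move=> He; have : integrable (fun w => `|X e w|).
  apply: weight_integrable => //.
  by rewrite mean_norm; move: X0_mean; rewrite unlock.
by apply: eq_integrable => // w _ /=; rewrite ger0_norm // X_ge0.
Qed.

Lemma edge_mean e : edge_set H e -> \int[P]_w X e w = mean.
Proof.
move=> He; congr fine; rewrite -mean_norm -(weight_transfer He) //.
by apply: eq_integral => w _; rewrite ger0_norm // X_ge0.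
Qed.

Definition weights (w : Omega) : set H -> R := fun e => X e w.

Lemma weights_nonneg w : nonneg_weight (weights w).
Proof. by move=> e; exact: X_ge0. Qed.

Lemma path_weight_integrable x p : path (@adj H) x p ->
  integrable (fun w => path_weight (weights w) x p).
Proof.
elim: p x => [|y p IH] x /=.
  move=> _; apply: eq_integrable (integrable_cst P 0) => // w _ /=.
  by rewrite path_weight_nil.
move=> /andP[xy yp].
apply: (@eq_integrable _ _ _ P _ measurableT
  (EFin \o (fun w => X [set x; y] w + path_weight (weights w) y p))).
  by move=> w _ /=; rewrite path_weight_cons.
by apply: integrable_addR; [apply: edge_integrable; exact: adj_edge|exact: IH].
Qed.

Lemma path_weight_mean x p : path (@adj H) x p ->
  \int[P]_w path_weight (weights w) x p = (size p)%:R * mean.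
Proof.
elim: p x => [|y p IH] x /=.
  move=> _; rewrite mul0r -[RHS](RintegralT_cst P); apply: eq_Rintegral => w _.
  by rewrite path_weight_nil.
move=> /andP[xy yp].
under eq_Rintegral do rewrite path_weight_cons.
rewrite RintegralD //; last 2 first.
- by apply: edge_integrable; exact: adj_edge.
- exact: path_weight_integrable.
by rewrite IH // [X in X + _]edge_mean; [rewrite -natr1 mulrDl mul1r addrC|exact: adj_edge].
Qed.

Lemma integrable_indicM f (V : set Omega) : measurable V -> (forall w, 0 <= f w) ->
  integrable f -> integrable (fun w => f w * \1_V w).
Proof.
move=> mV f0 fi; apply: (@integrable_le _ _ _ _ _ f) => //.
  apply: measurable_funM; first exact: integrable_measurable fi.
  exact: measurable_indic.
by move=> w; rewrite indicE; case: (_ \in _); rewrite ?mulr1 ?mulr0 f0 lexx.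
Qed.

(** Truncating each edge separately at the level t. *)
Lemma path_weight_indic_le (V : set Omega) (eps t : R) x p : measurable V ->
  0 < eps -> 0 < t -> ('E_Q[fun w => (X0 w `^ (1 + eps))%R] < +oo)%E ->
  path (@adj H) x p ->
  \int[P]_w (path_weight (weights w) x p * \1_V w) <=
    (size p)%:R * (t * fine (P V) + t `^ (- eps) * \int[Q]_w (X0 w `^ (1 + eps))).
Proof.
move=> mV eps0 t0 moment; have mphi : measurable_fun setT (fun x : R => x `^ (1 + eps)).
  exact: measurable_powR.
elim: p x => [|y p IH] x /=.
  move=> _; rewrite mul0r (@eq_Rintegral _ _ _ _ _ (cst 0)) ?RintegralT_cst // => w _.
  by rewrite path_weight_nil mul0r.
move=> /andP[xy yp]; have He := adj_edge xy.
under eq_Rintegral do rewrite path_weight_cons mulrDl.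
rewrite RintegralD //; last 2 first.
- apply: integrable_indicM => //; last exact: edge_integrable.
  by move=> w; exact: X_ge0.
- apply: integrable_indicM => //; last exact: path_weight_integrable.
  by move=> w; apply: path_weight_ge0 => //; exact: weights_nonneg.
rewrite -natr1 mulrDl mul1r addrC lerD ?IH //.
have moment' : (\int[Q]_w (X0 w `^ (1 + eps))%:E < +oo)%E.
  by move: moment; rewrite unlock.
have -> : \int[Q]_w (X0 w `^ (1 + eps)) = \int[P]_w (X [set x; y] w `^ (1 + eps)).
  congr fine; rewrite -(weight_transfer He mphi) // => z; exact: powR_ge0.
apply: Rintegral_indic_le => //.
- by move=> w; exact: X_ge0.
- exact: edge_integrable.
- by apply: (weight_integrable He mphi) => // z; exact: powR_ge0.
Qed.

Lemma fpp_dist_integrable (hH : locally_countable H) x y :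
  (exists p, is_path x y p) -> integrable (fun w => fpp_dist (weights w) x y).
Proof.
move=> [p [xp lp _]].
apply: (@integrable_le _ _ _ _ _ (fun w => path_weight (weights w) x p)).
- apply: measurable_fpp_dist => //; exact: weights_nonneg.
- by move=> w; have w0 := weights_nonneg w; apply/andP; split;
    [exact: fpp_dist_ge0|exact: fpp_dist_le].
- exact: path_weight_integrable.
Qed.

End EdgeWeights.

Section Pigeonhole.
Context (R : realType) dO (Omega : measurableType dO) (P : probability Omega R).
Local Notation integrable f := (P.-integrable setT (EFin \o f)).

Lemma sum_indic_integrable (I : Type) (s : seq I) (V : I -> set Omega) :
  (forall i, measurable (V i)) ->
  integrable (fun w => \sum_(i <- s) \1_(V i) w) /\
  \int[P]_w (\sum_(i <- s) \1_(V i) w) = \sum_(i <- s) fine (P (V i)).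
Proof.
move=> mV.
have i1 i := integrable_indic_set P (mV i).
elim: s => [|i s [IH1 IH2]].
  split; last first.
    rewrite big_nil -[RHS](RintegralT_cst P); apply: eq_Rintegral => w _.
    by rewrite big_nil.
  apply: eq_integrable (integrable_cst P 0) => // w _ /=.
  by rewrite big_nil.
split.
  apply: (@eq_integrable _ _ _ P _ measurableT
    (EFin \o (fun w => \1_(V i) w + \sum_(i <- s) \1_(V i) w))).
    by move=> w _ /=; rewrite big_cons.
  exact: integrable_addR.
under eq_Rintegral do rewrite big_cons.
by rewrite RintegralD // IH2 big_cons Rintegral_indic_set.
Qed.

(** A sequence of length l meets at most l of the given points, so some point
    is met with probability at most the mean length over their number. *)
Lemma least_visited (S T : choiceType) (pi : S -> T) (gamma : Omega -> seq S)
    (vs : seq T) (m : R) :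
  (forall A : set (seq S), measurable (gamma @^-1` A)) ->
  ('E_P[fun w => ((size (gamma w))%:R : R)] <= m%:E)%E ->
  uniq vs -> (0 < size vs)%N ->
  exists2 v, v \in vs &
    (size vs)%:R * fine (P [set w | v \in map pi (gamma w)]) <= m.
Proof.
move=> mgamma gammam uvs vs0.
pose V v := [set w | v \in map pi (gamma w)].
have mV v : measurable (V v) by exact: (mgamma [set p | v \in map pi p]).
have msize : measurable_fun setT (fun w => (size (gamma w))%:R : R).
  move=> _ B mB; rewrite setTI; exact: (mgamma [set p | B (size p)%:R]).
have isize : integrable (fun w => (size (gamma w))%:R : R).
  apply/integrableP; split; first exact/measurable_EFinP.
  apply: le_lt_trans (ltry m); move: gammam; rewrite unlock; apply: le_trans.
  by apply: ge0_le_integral => //=; try exact/measurable_EFinP;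
    [apply/measurable_EFinP; exact: measurableT_comp|move=> w _; rewrite ger0_norm].
have sizem : \int[P]_w ((size (gamma w))%:R : R) <= m.
  move: gammam; rewrite unlock /Rintegral => h.
  rewrite -lee_fin fineK //; exact: integrable_fin_num.
have [isum Esum] := sum_indic_integrable vs mV.
have le_m : \sum_(v <- vs) fine (P (V v)) <= m.
  apply: le_trans sizem; rewrite -Esum; apply: le_RintegralT => // w.
  have -> : \sum_(v <- vs) \1_(V v) w = (count (mem (map pi (gamma w))) vs)%:R :> R.
    elim: (vs) => [|v s IH]; first by rewrite big_nil.
    by rewrite big_cons IH /= natrD indicE; congr (_%:R + _); rewrite mem_setE.
  rewrite ler_nat -size_filter -(size_map pi); apply: uniq_leq_size.
    exact: filter_uniq.
  by move=> v; rewrite mem_filter => /andP[].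
have [v0 v0in] : exists v, v \in vs.
  by case: (vs) vs0 => // v s _; exists v; rewrite mem_head.
have vsR : 0 < (size vs)%:R :> R by rewrite ltr0n.
apply: contrapT => hno.
have : \sum_(v <- vs) (m / (size vs)%:R) < \sum_(v <- vs) fine (P (V v)).
  rewrite !big_seq; apply: ltr_sum; last first.
    move=> v vin; rewrite ltr_pdivrMr // mulrC ltNge; apply/negP => vm.
    by apply: hno; exists v.
  by apply/hasP; exists v0.
by rewrite big_const_seq count_predT iter_addr_0 -[_ *+ _]mulr_natr divfK ?gt_eqF // ltNge le_m.
Qed.

End Pigeonhole.

(** * Passage times in two disjoint copies *)

Lemma measurable_fpp_dist_weight_space (R : realType) (H : sgraph) (x y : H) :
  locally_countable H ->
  measurable_fun setT (fun z : weight_space R (edge_set H) =>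
    fpp_dist (fun e => `|z e|) x y).
Proof.
move=> hH; apply: measurable_fpp_dist => // [e He|z e _]; last exact: normr_ge0.
by apply: measurableT_comp => //; exact: measurable_coord.
Qed.

Section Copies.
Context (R : realType) (W H : sgraph) (phi psi : W -> H).
Hypothesis hW : locally_countable W.
Hypotheses (phi_inj : injective phi) (psi_inj : injective psi).
Hypothesis phi_hom : forall x y, adj x y -> adj (phi x) (phi y).
Hypothesis psi_hom : forall x y, adj x y -> adj (psi x) (psi y).
Hypothesis phi_psi : forall x y, phi x <> psi y.
Context dO' (Omega' : measurableType dO') (Q : probability Omega' R).
Context (X0 : {RV Q >-> R}) dO (Omega : measurableType dO) (P : probability Omega R).
Variable X : set H -> {RV P >-> R}.
Hypothesis hX : iid_edge_weights X X0.

Lemma image_preimage_inj (f : W -> H) : injective f ->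
  cancel (fun e => f @` e) (fun e => f @^-1` e).
Proof.
move=> f_inj e; apply/seteqP; split => x /=; last by move=> ex; exists x.
by move=> [y ey /f_inj <-].
Qed.

Let phi_psi_edge (e e' : set W) : edge_set W e -> edge_set W e' ->
  phi @` e <> psi @` e'.
Proof.
move=> [u [v [_ ->]]] _ E.
have : (phi @` [set u; v]) (phi u) by exists u => //; left.
by rewrite E => -[y _ /esym/phi_psi].
Qed.

Let F x y (z : weight_space R (edge_set W)) : R := fpp_dist (fun e => `|z e|) x y.

Let FE (f : W -> H) (f_hom : forall x y, adj x y -> adj (f x) (f y)) x y w :
  fpp_dist (pullback f (weights X w)) x y =
  F x y (block (edge_set W) X (fun e => f @` e) w).
Proof.
apply: eq_fpp_dist => e We; rewrite /block ger0_norm //.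
case: hX => _ _; apply; exact: image_edge.
Qed.

(** The distances in two disjoint copies of W are the same measurable function
    of two disjoint blocks of weights. *)
Lemma copies_same_law x y (B : set R) : measurable B ->
  P ((fun w => fpp_dist (pullback phi (weights X w)) x y) @^-1` B) =
  P ((fun w => fpp_dist (pullback psi (weights X w)) x y) @^-1` B).
Proof.
move=> mB; have [hind hlaw _] := hX.
have mF : measurable (F x y @^-1` B).
  by rewrite -[X in measurable X]setTI; exact: measurable_fpp_dist_weight_space.
under eq_fun do rewrite (FE phi_hom).
under [in RHS]eq_fun do rewrite (FE psi_hom).
by have := block_law hind hlaw (image_preimage_inj phi_inj)
  (image_preimage_inj psi_inj) (image_edge phi_hom) (image_edge psi_hom)
  phi_psi_edge mF.
Qed.

Lemma copies_indep x y (B C : set R) : measurable B -> measurable C ->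
  P ((fun w => fpp_dist (pullback phi (weights X w)) x y) @^-1` B `&`
     (fun w => fpp_dist (pullback psi (weights X w)) x y) @^-1` C) =
  (P ((fun w => fpp_dist (pullback phi (weights X w)) x y) @^-1` B) *
   P ((fun w => fpp_dist (pullback psi (weights X w)) x y) @^-1` C))%E.
Proof.
move=> mB mC; have [hind hlaw _] := hX.
have mF D : measurable D -> measurable (F x y @^-1` D).
  move=> mD; rewrite -[X in measurable X]setTI.
  exact: measurable_fpp_dist_weight_space.
have hphi : (fun w => fpp_dist (pullback phi (weights X w)) x y) =
    F x y \o block (edge_set W) X (fun e => phi @` e).
  by apply/funext => w; exact: FE.
have hpsi : (fun w => fpp_dist (pullback psi (weights X w)) x y) =
    F x y \o block (edge_set W) X (fun e => psi @` e).
  by apply/funext => w; exact: FE.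
rewrite hphi hpsi.
by have := block_indep hind hlaw (image_preimage_inj phi_inj)
  (image_preimage_inj psi_inj) (image_edge phi_hom) (image_edge psi_hom)
  phi_psi_edge (mF _ mB) (mF _ mC).
Qed.

End Copies.

(** * Cutting the tree at a rarely visited vertex *)

Section Tightness.
Variables (d : nat) (hd : (3 <= d)%N).
Variables (T : sgraph) (hT : is_regular_tree d T) (rho : T).
Variables (G : sgraph) (hG : locally_countable G).
Variables (r : nat -> G) (hr : is_ray r).
Context (R : realType) dO' (Omega' : measurableType dO') (Q : probability Omega' R).
Context (X0 : {RV Q >-> R}) dO (Omega : measurableType dO) (P : probability Omega R).
Local Notation TG := (cartesian_product T G).
Local Notation WG := (cartesian_product (word_tree d.-1) G).
Variable X : set TG -> {RV P >-> R}.
Hypothesis X0_ge0 : forall w, 0 <= X0 w.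
Hypothesis X0_mean : ('E_Q[X0] < +oo)%E.
Hypothesis hX : iid_edge_weights X X0.

Let mean : R := \int[Q]_w X0 w.
Let X_law : forall e, edge_set TG e -> same_law (X e) X0. Proof. by case: hX. Qed.
Let X_ge0 : forall e w, edge_set TG e -> 0 <= X e w. Proof. by case: hX. Qed.

Let TG_countable : locally_countable TG.
Proof. exact: locally_countable_product (regular_locally_countable hT) hG. Qed.

Lemma regular_neighbour : exists a, adj a rho.
Proof.
have [_ /(_ rho) h] := hT.
have : [set y | adj rho y] !=set0.
  apply/set0P/negP => /eqP E; move: h; rewrite E card_eq_sym card_eq0 => /eqP I0.
  have : `I_d 0%N by rewrite /=; lia.
  by rewrite I0.
by move=> [a ra]; exists a; rewrite adj_sym.
Qed.

Definition ray_dist (n : nat) (w : Omega) : R :=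
  fpp_dist (weights X w) ((rho, r 0%N) : TG) (rho, r n).

Lemma ray_dist_integrable n : P.-integrable setT (EFin \o ray_dist n).
Proof.
apply: (fpp_dist_integrable X0_ge0 X0_mean X_law X_ge0 TG_countable).
by exists (ray_path r rho n); exact: ray_is_path.
Qed.

(** There are (d-1)^(l+1) >= 2^(l+1) vertices at distance l+1 from rho on the
    branch of (a0, rho); the path gamma can meet only few of them. *)
Lemma rarely_visited (a0 : T) (l : nat) (gamma : Omega -> seq TG) (m : R) :
  adj a0 rho -> (forall A : set (seq TG), measurable (gamma @^-1` A)) ->
  ('E_P[fun w => ((size (gamma w))%:R : R)] <= m%:E)%E ->
  exists i (s : word_tree d.-1), size s = l /\
    2 ^+ l.+1 * fine (P [set w | branch a0 rho (i :: s) \in map fst (gamma w)]) <= m.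
Proof.
move=> a0r mgamma gammam.
pose vs := [seq branch a0 rho (val t) | t : l.+1.-tuple 'I_d.-1].
have vs_size : size vs = (d.-1 ^ l.+1)%N by rewrite size_map -cardE card_tuple card_ord.
have vs_uniq : uniq vs.
  rewrite map_inj_uniq ?enum_uniq //.
  by move=> t t' /(branch_inj hT a0r) /val_inj.
have vs0 : (2 ^ l.+1 <= size vs)%N by rewrite vs_size leq_exp2r //; lia.
have [] := least_visited fst mgamma gammam vs_uniq.
  by apply: leq_trans vs0; rewrite expn_gt0.
move=> v /mapP[[[|i s] /= /eqP st] _ ->]; first by [].
move=> h; exists i, s; split; first by case: st.
apply: le_trans h; rewrite ler_wpM2r ?fine_ge0 //.
by rewrite -natrX ler_nat.
Qed.

(** Cut the tree just before a rarely visited vertex v. The distance f restricted to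
    the side of rho and its copy g on the side of v are independent and have the
    same law, D <= f, and D <= g + h where h is the cost of passing from rho to
    its counterpart, at both ends of the ray. Moreover f = D unless the
    minimizing path visits v; on that rare event f - D is at most the weight of
    the ray, whose mean there is controlled by the moment of order 1 + eps. *)
Lemma mean_deviation_ray_dist (n l : nat) (gamma : Omega -> seq TG) (m eps t : R) :
  minimizing_selection X ((rho, r 0%N) : TG) (rho, r n) gamma ->
  ('E_P[fun w => ((size (gamma w))%:R : R)] <= m%:E)%E ->
  0 < eps -> 0 < t -> ('E_Q[fun w => (X0 w `^ (1 + eps))%R] < +oo)%E ->
  \int[P]_w `|ray_dist n w - \int[P]_u ray_dist n u| <=
    4 * (n%:R * (t * (m / 2 ^+ l.+1) +
                 t `^ (- eps) * \int[Q]_w (X0 w `^ (1 + eps)))) +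
    8 * l.+1%:R * mean.
Proof.
move=> [mgamma min_gamma] gammam eps0 t0 moment.
have [a0 a0r] := regular_neighbour.
have [i [s [sl visit]]] := rarely_visited l a0r mgamma gammam.
have [vu [s' [s'rho [q [q1 q2 q3]]]]] := branch_split hT i s a0r.
set v := branch a0 rho (i :: s) in vu s'rho q2 visit.
set u := branch a0 rho s in vu s'rho q2.
have uv : adj u v by rewrite adj_sym.
have [q' [q'1 q'2 q'3]] := walk_sym q1; rewrite q2 in q'1 q'2.
pose phi := @prod_embed (word_tree d.-1) T G (branch v u).
pose psi := @prod_embed (word_tree d.-1) T G (branch u v).
have phi_inj : injective phi by apply: prod_embed_inj; exact: branch_inj.
have psi_inj : injective psi by apply: prod_embed_inj; exact: branch_inj.
have phi_hom x y : adj x y -> adj (phi x) (phi y).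
  by apply: prod_embed_hom => ? ?; exact: branch_hom.
have psi_hom x y : adj x y -> adj (psi x) (psi y).
  by apply: prod_embed_hom => ? ?; exact: branch_hom.
have phi_psi x y : phi x <> psi y by move=> [+ _]; exact: branch_disjoint.
have WG_countable : locally_countable WG.
  exact: locally_countable_product (@word_tree_locally_countable _) hG.
pose x0 : WG := (s', r 0%N); pose xn : WG := (s', r n).
have ray_p : exists p, is_path x0 xn p.
  by exists (ray_path r (s' : word_tree _) n); exact: ray_is_path.
have phi0 : phi x0 = (rho, r 0%N) by rewrite /phi /prod_embed /= s'rho.
have phin : phi xn = (rho, r n) by rewrite /phi /prod_embed /= s'rho.
pose f w := fpp_dist (pullback phi (weights X w)) x0 xn.
pose g w := fpp_dist (pullback psi (weights X w)) x0 xn.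
have Xw0 w : nonneg_weight (weights X w) by move=> e; exact: X_ge0.
pose S w := path_weight (weights X w) (phi x0) (map phi (ray_path r (s' : word_tree _) n)).
pose S' w := path_weight (weights X w) (psi x0) (map psi (ray_path r (s' : word_tree _) n)).
have ray_P := ray_is_path hr (s' : word_tree d.-1) n.
have ray_phi : path (@adj TG) (phi x0) (map phi (ray_path r (s' : word_tree _) n)).
  by apply: path_hom => //; case: ray_P.
have ray_psi : path (@adj TG) (psi x0) (map psi (ray_path r (s' : word_tree _) n)).
  by apply: path_hom => //; case: ray_P.
have Si : P.-integrable setT (EFin \o S).
  exact: (path_weight_integrable X0_ge0 X0_mean X_law X_ge0).
have S'i : P.-integrable setT (EFin \o S').
  exact: (path_weight_integrable X0_ge0 X0_mean X_law X_ge0).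
have f_bound w : 0 <= f w <= S w.
  have w0 := pullback_nonneg phi_hom (Xw0 w); rewrite fpp_dist_ge0 //=.
  by rewrite /S path_weight_map; case: ray_P => ? ? _; exact: fpp_dist_le.
have g_bound w : 0 <= g w <= S' w.
  have w0 := pullback_nonneg psi_hom (Xw0 w); rewrite fpp_dist_ge0 //=.
  by rewrite /S' path_weight_map; case: ray_P => ? ? _; exact: fpp_dist_le.
have fi : P.-integrable setT (EFin \o f).
  apply: integrable_le f_bound Si; apply: measurable_fpp_dist => //.
  by move=> w; exact: pullback_nonneg.
have gi : P.-integrable setT (EFin \o g).
  apply: integrable_le g_bound S'i; apply: measurable_fpp_dist => //.
  by move=> w; exact: pullback_nonneg.
pose p1 := [seq ((y, r 0%N) : TG) | y <- q].
pose p2 := [seq ((y, r n) : TG) | y <- q'].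
pose h w := path_weight (weights X w) (rho, r 0%N) p1 +
            path_weight (weights X w) (psi xn) p2.
have p1P : path (@adj TG) (rho, r 0%N) p1 by exact: path_at_level.
have p2P : path (@adj TG) (psi xn) p2 by exact: path_at_level.
have h1i := path_weight_integrable X0_ge0 X0_mean X_law X_ge0 p1P.
have h2i := path_weight_integrable X0_ge0 X0_mean X_law X_ge0 p2P.
have hi : P.-integrable setT (EFin \o h) by exact: integrable_addR.
have h0 w : 0 <= h w by rewrite addr_ge0 ?path_weight_ge0.
have mean0 : 0 <= mean by apply: Rintegral_ge0 => w _.
(* Two walks of at most 2 l + 1 edges. *)
have hE : \int[P]_w h w <= 4 * l.+1%:R * mean.
  rewrite RintegralD // !(path_weight_mean X0_ge0 X0_mean X_law X_ge0) //.
  rewrite -mulrDl ler_wpM2r // -natrD -natrM ler_nat !size_map q'3.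
  by apply: leq_trans (leq_add q3 q3) _; rewrite sl; clear; lia.
have Df w : ray_dist n w <= f w.
  by rewrite /ray_dist -phi0 -phin; exact: fpp_dist_embed.
have Dg w : ray_dist n w <= g w + h w.
  rewrite /ray_dist /g /h addrCA addrA.
  apply: fpp_dist_detour => //.
  - by apply: etrans (last_map (fun y => (y, r 0%N) : TG) q rho) _; rewrite /= q2.
  - by apply: etrans (last_map (fun y => (y, r n) : TG) q' _) _; rewrite /= q'2.
pose V := gamma @^-1` [set p | v \in map fst p].
have mV : measurable V by exact: mgamma.
have PV : fine (P V) <= m / 2 ^+ l.+1.
  by rewrite ler_pdivlMr ?exprn_gt0 // mulrC.
(* N is a null set that contains the outcomes with a non-minimizing gamma. *)
have [N [mN PN Nbad]] := min_gamma.
have mVN : measurable (V `|` N) by exact: measurableU.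
have PVN : fine (P (V `|` N)) <= m / 2 ^+ l.+1.
  apply: le_trans PV; apply: fine_le; rewrite ?fin_num_measure //.
  apply: le_trans (measureU2 _ mV mN) _.
  by rewrite [X in (_ + X)%E](_ : _ = 0%E) ?adde0 //; exact: PN.
have fD w : f w - ray_dist n w <= S w * \1_(V `|` N) w.
  have /andP[f0 fS] := f_bound w.
  rewrite indicE; have [|wVN] := boolP (w \in V `|` N).
    move=> _; rewrite mulr1 lerBlDr (le_trans fS) // lerDl.
    exact: fpp_dist_ge0.
  rewrite mulr0 subr_le0; move/negP: wVN; rewrite inE => wVN.
  have wmin : is_minimizing (weights X w) ((rho, r 0%N) : TG) (rho, r n) (gamma w).
    by apply: contrapT => bad; apply: wVN; right; exact: Nbad.
  (* A path that avoids v stays on the side of rho, hence lifts to words. *)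
  have [p pE x0p] : exists2 p, map phi p = gamma w & path (@adj WG) x0 p.
    have [[wpath _ _] _] := wmin.
    apply: (@prod_path_lift _ _ _ (branch v u) v).
    - by move=> z y zy yv; exact: branch_cover zy yv.
    - by rewrite -/phi phi0.
    - by apply/negP => vin; apply: wVN; left.
  rewrite /ray_dist -phi0 -phin; apply: (fpp_dist_lift _ _ _ x0p) => //.
  by rewrite pE phi0 phin.
have delta : \int[P]_w f w - \int[P]_w ray_dist n w <=
    n%:R * (t * (m / 2 ^+ l.+1) + t `^ (- eps) * \int[Q]_w (X0 w `^ (1 + eps))).
  rewrite -RintegralB //; last exact: ray_dist_integrable.
  apply: (@le_trans _ _ (\int[P]_w (S w * \1_(V `|` N) w))).
    apply: le_RintegralT => //; last first.
      by apply: integrable_indicM => // w; have /andP[/le_trans] := f_bound w; apply.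
    by apply: integrable_subR => //; exact: ray_dist_integrable.
  apply: le_trans (path_weight_indic_le X0_ge0 X0_mean X_law X_ge0 mVN eps0 t0 moment ray_phi) _.
  rewrite size_map size_ray_path ler_wpM2l // lerD2r.
  by rewrite ler_wpM2l // ltW.
apply: le_trans (mean_deviation_le fi gi hi (ray_dist_integrable n) Df Dg h0 _ delta _) _.
- apply: Rintegral_same_law => // B mB.
  exact: (copies_same_law WG_countable phi_inj psi_inj phi_hom psi_hom phi_psi hX).
- apply: indep_mean_deviation => // B C mB mC.
  exact: (copies_indep WG_countable phi_inj psi_inj phi_hom psi_hom phi_psi hX).
rewrite lerD2l; lra.
Qed.

End Tightness.

(** * Tightness *)

Lemma powR_exp_le (R : realType) (n l : nat) (b a : R) : (1 <= n)%N ->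
  a <= b -> b * ln n%:R <= l%:R * ln 2 -> n%:R `^ a <= 2 ^+ l :> R.
Proof.
move=> n1 ab bl; have n0 : 0 < n%:R :> R by rewrite ltr0n.
rewrite -powR_mulrn // /powR (gt_eqF n0) pnatr_eq0 /= ler_expR.
by apply: le_trans bl; rewrite ler_wpM2r // ln_ge0 // ler1n.
Qed.
Theorem mainTheorem1
    (d : nat) (hd : (3 <= d)%N)
    (T : sgraph) (hT : is_regular_tree d T) (rho : T)
    (G : sgraph) (hG : locally_countable G)
    (r : nat -> G) (hr : is_ray r)
    (R : realType)
    (* the generic weight X *)
    (dO' : measure_display) (Omega' : measurableType dO')
    (Q : probability Omega' R) (X0 : {RV Q >-> R})
    (hX0 : forall w, 0 <= X0 w)
    (hEX0 : ('E_Q[X0] < +oo)%E)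
    (* the i.i.d. edge weights X_e *)
    (dO : measure_display) (Omega : measurableType dO)
    (P : probability Omega R)
    (X : set (cartesian_product T G) -> {RV P >-> R})
    (hX : iid_edge_weights X X0)
    (h1 : exists2 eps : R,
        0 < eps & ('E_Q[fun w => (X0 w `^ (1 + eps))%R] < +oo)%E)
    (gamma : nat -> Omega -> seq (cartesian_product T G))
    (hgamma : forall n : nat, (1 <= n)%N ->
        minimizing_selection X (rho, r 0%N) (rho, r n) (gamma n))
    (h2 : exists C K : R, forall n : nat, (1 <= n)%N ->
        ('E_P[fun w => ((size (gamma n w))%:R : R)] < (C * n%:R `^ K)%R%:E)%E) :
  let D (n : nat) (w : Omega) : R :=
    fpp_dist (fun e => X e w) (rho, r 0%N) (rho, r n) in
  tight P [set n : nat | (2 <= n)%N]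
    (fun n w => (D n w - fine ('E_P[D n])%E) / ln n%:R).
Proof.
move=> D; have [eps eps0 moment] := h1; have [C [K lenK]] := h2.
set mean := \int[Q]_w X0 w; set M := \int[Q]_w (X0 w `^ (1 + eps)).
have mean0 : 0 <= mean by apply: Rintegral_ge0 => w _; exact: hX0.
have M0 : 0 <= M by apply: Rintegral_ge0 => w _; exact: powR_ge0.
(* 2 ^ l.+1 beats n ^ alpha, while l is of order log n. *)
pose alpha := `|K| + 1 + eps^-1.
have alpha0 : 0 <= alpha by rewrite !addr_ge0 // invr_ge0 ltW.
have ln2 : 0 < ln 2 :> R by rewrite ln_gt0 // ltr1n.
have C0 : 0 <= C.
  have := lenK 1%N isT; rewrite powR1 mulr1 => /ltW; rewrite -lee_fin; apply: le_trans.
  by apply: expectation_ge0.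
pose c := (4 * (C + M) + 8 * mean * (alpha + 1)) / ln 2.
have c0 : 0 <= c.
  by rewrite divr_ge0 ?(ltW ln2) // addr_ge0 // !mulr_ge0 // addr_ge0.
have Di n : P.-integrable setT (EFin \o D n).
  exact: (ray_dist_integrable hT rho hG hr hX0 hEX0 hX).
have mean_dev n : (2 <= n)%N ->
    \int[P]_w `|D n w - \int[P]_u D n u| <= c * ln n%:R.
  move=> n2; have n1 : (1 <= n)%N by exact: ltnW.
  have n0 : 0 < n%:R :> R by rewrite ltr0n.
  pose y : R := ln n%:R / ln 2.
  have y1 : 1 <= y.
    by rewrite ler_pdivlMr // mul1r ler_ln ?posrE // ler_nat.
  pose l := Num.truncn (alpha * y).
  have ay0 : 0 <= alpha * y by rewrite mulr_ge0 // (le_trans _ y1).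
  have l1 : alpha * y <= l.+1%:R by exact/ltW/truncnS_gt.
  have l2 : l.+1%:R <= (alpha + 1) * y.
    by rewrite -natr1 mulrDl mul1r lerD //; rewrite truncn_le.
  (* The truncation level makes the tail t ^ (- eps) equal to 1 / n. *)
  pose t : R := n%:R `^ eps^-1.
  have t0 : 0 < t by exact: powR_gt0.
  have := mean_deviation_ray_dist hd hT hG hr hX0 hEX0 hX l (hgamma n n1)
    (ltW (lenK n n1)) eps0 t0 moment.
  rewrite -/mean -/M => /le_trans; apply.
  have tE : t `^ (- eps) = n%:R^-1.
    by rewrite -powRrM mulrN mulVf ?gt_eqF // powR_inv1 // ltW.
  have main_le : n%:R * (t * (C * n%:R `^ K / 2 ^+ l.+1)) <= C.
    rewrite (_ : n%:R * _ = C * (n%:R `^ (1 + eps^-1 + K)) / 2 ^+ l.+1); last first.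
      have powD a b : n%:R `^ (a + b) = n%:R `^ a * n%:R `^ b :> R.
        by rewrite powRD // (gt_eqF n0) implybT.
      by rewrite !powD powRr1 ?ltW // /t; ring.
    rewrite ler_pdivrMr ?exprn_gt0 // ler_wpM2l //.
    apply: (@powR_exp_le _ _ _ alpha) => //.
      by rewrite /alpha; have := ler_norm K; lra.
    by rewrite -ler_pdivrMr // -mulrA.
  have cE : c * ln n%:R = (4 * (C + M) + 8 * mean * (alpha + 1)) * y.
    by rewrite /c /y mulrAC mulrA.
  have M_le : n%:R * (n%:R^-1 * M) = M by rewrite mulVKf // gt_eqF.
  rewrite cE tE mulrDr M_le.
  have CM : 4 * (C + M) <= 4 * (C + M) * y.
    by rewrite ler_peMr // mulr_ge0 // addr_ge0.
  have lm : 8 * l.+1%:R * mean <= 8 * mean * (alpha + 1) * y.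
    rewrite mulrAC -[leRHS]mulrA ler_wpM2l // mulr_ge0 //.
  by rewrite [leRHS]mulrDl lerD // (le_trans _ CM) // ler_wpM2l // lerD2r.
move=> eta eta0; exists ((c + 1) / eta) => n n2.
have lnn : 0 < ln n%:R :> R by rewrite ln_gt0 // ltr1n.
have EDE : fine 'E_P[D n]%E = \int[P]_w D n w by rewrite unlock.
rewrite EDE; set ED := \int[P]_w D n w.
have M1 : 0 < (c + 1) / eta by rewrite divr_gt0 // ltr_wpDl.
have -> : [set w | (c + 1) / eta < `|(D n w - ED) / ln n%:R|] =
          [set w | (c + 1) / eta * ln n%:R < `|D n w - ED|].
  by apply/seteqP; split => w /=; rewrite normrM normfV (gtr0_norm lnn) ltr_pdivlMr.
have Ti : P.-integrable setT (EFin \o (fun w => D n w - ED)).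
  by apply: integrable_subR => //; exact: integrable_cst.
have := markov_Rintegral (mulr_gt0 M1 lnn) Ti.
set A := [set w | _]; move=> /le_trans /(_ (mean_dev n n2)) PA.
have mA : measurable A.
  by apply: measurable_norm_gt; exact: integrable_measurable Ti.
rewrite -[P A]fineK ?fin_num_measure // lee_fin.
have : (c + 1) / eta * fine (P A) <= c.
  by rewrite -(ler_pM2r lnn) mulrAC.
rewrite mulrAC ler_pdivrMr // => h.
have p0 : 0 <= fine (P A) by exact: fine_ge0.
nra.
Qed.
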